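(* Let $k_0>0$, let $\mu_n$ ($n\in\mathbb{N}$) be complex Borel measures on the closed ball $\{\mathbf{k}\in\mathbb{R}^2:|\mathbf{k}|\le k_0\}$, and set $F_n(\mathbf{z})=\int_{|\mathbf{k}|\le k_0}e^{i\mathbf{k}\mathbf{z}}d\mu_n(\mathbf{k})$, $\mathbf{z}\in\mathbb{C}^2$. Suppose there is $\mathbf{a}\in\mathbb{R}^2$ with $|\mathbf{a}|>k_0$ such that $F_n\to e^{i\mathbf{a}\,\cdot}$ in $\mathcal{A}_1(\mathbb{C}^2)$. Then for all $t>0$, $\mathbf{x}\in\Omega$ and $n\in\mathbb{N}$, $$\Psi_{D,N}(t,\mathbf{x};F_n)=\int_{|\mathbf{k}|\le k_0}\Psi_{D,N}\big(t,\mathbf{x};e^{i\mathbf{k}\,\cdot}\big)\,d\mu_n(\mathbf{k}),$$ and $\lim_{n\to\infty}\Psi_{D,N}(t,\mathbf{x};F_n)=\Psi_{D,N}(t,\mathbf{x};e^{i\mathbf{a}\,\cdot})$ uniformly on compact subsets of $(0,\infty)\times\Omega$. In other words, the sequence $(\Psi_{D,N}(\cdot,\cdot;F_n))_n$ admits a supershift on $X=(0,\infty)\times\Omega$ with respect to the family $\varphi_{\mathbf{k}}(t,\mathbf{x})=\Psi_{D,N}(t,\mathbf{x};e^{i\mathbf{k}\,\cdot})$.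
   Context: Here $\mathbf{k}\mathbf{z}=k_1z_1+k_2z_2$ (bilinear), $e^{i\mathbf{k}\,\cdot}$ denotes the function $\mathbf{z}\mapsto e^{i\mathbf{k}\mathbf{z}}$, and $|\mathbf{z}|=\sqrt{|z_1|^2+|z_2|^2}$. Let $\Gamma=\{(0,x_2):x_2\le0\}$, $\Omega=\mathbb{R}^2\setminus\Gamma$; write $\mathbf{x}\in\Omega$ as $\mathbf{x}=r(\cos\varphi,\sin\varphi)$, $r>0$, $\varphi\in(-\frac{\pi}{2},\frac{3\pi}{2})$. $\mathcal{A}_1(\mathbb{C}^2)$ is the space of entire $F:\mathbb{C}^2\to\mathbb{C}$ with $|F(\mathbf{z})|\le Ae^{B|\mathbf{z}|}$ for some $A,B\ge0$; $F_n\to F_0$ in $\mathcal{A}_1(\mathbb{C}^2)$ means there is $B\ge0$ with $\lim_{n}\sup_{\mathbf{z}\in\mathbb{C}^2}|F_n(\mathbf{z})-F_0(\mathbf{z})|e^{-B|\mathbf{z}|}=0$. Let $\Lambda(z)=\frac{2}{\sqrt{\pi}}\int_0^\infty e^{-s^2-2zs}ds$. For $t>0$, $\mathbf{x}\in\Omega$, $\mathbf{y}=\rho(\cos\theta,\sin\theta)\in\Omega$ ($\rho>0$, $\theta\in(-\frac{\pi}{2},\frac{3\pi}{2})$) the Green's functions of $i\partial_t\Psi=-\Delta\Psi$ on $\Omega$ with Dirichlet ($\Psi=0$, index $D$) resp. Neumann ($\partial_{x_1}\Psi=0$, index $N$) condition on $\Gamma$ are $$G_{D,N}(t,\mathbf{x},\mathbf{y})=\frac{e^{-\frac{(r+\rho)^2}{4it}}}{8i\pi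 t}\Big(\Lambda\Big(\tfrac{\sqrt{r\rho}\cos(\frac{\varphi-\theta}{2})}{\sqrt{it}}\Big)\mp\Lambda\Big(-\tfrac{\sqrt{r\rho}\sin(\frac{\varphi+\theta}{2})}{\sqrt{it}}\Big)\Big)$$ ($-$ for $D$, $+$ for $N$, $\sqrt{it}$ principal). For $F\in\mathcal{A}_1(\mathbb{C}^2)$ the wave function is $\Psi_{D,N}(t,\mathbf{x};F)=\lim_{\varepsilon\to0^+}\int_\Omega e^{-\varepsilon|\mathbf{y}|^2}G_{D,N}(t,\mathbf{x},\mathbf{y})F(\mathbf{y})d\mathbf{y}$ (the limit exists). Supershift: given a metric space $X$ and functions $\varphi_{\mathbf{k}}:X\to\mathbb{C}$ with $\mathbf{k}\mapsto\varphi_{\mathbf{k}}(s)$ continuous, a sequence $\Phi_n(s)=\int_{|\mathbf{k}|\le k_0}\varphi_{\mathbf{k}}(s)d\mu_n(\mathbf{k})$ admits a supershift if there is $\mathbf{a}$ with $|\mathbf{a}|>k_0$ such that $\Phi_n\to\varphi_{\mathbf{a}}$ uniformly on compact subsets of $X$. *)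

(* Defs.v *)
From HB Require Import structures.
From mathcomp Require Import all_boot all_order all_algebra.
From mathcomp Require Import all_classical all_reals all_analysis.
From mathcomp Require Import complex.
Set Implicit Arguments. Unset Strict Implicit. Unset Printing Implicit Defensive.
Import Order.TTheory GRing.Theory Num.Theory.
Import numFieldNormedType.Exports.
Local Open Scope classical_set_scope.
Local Open Scope ring_scope.
Local Open Scope complex_scope.

Section Defs.
Variable R : realType.
Local Notation C := R[i].
Local Notation RR := (R * R)%type.

Definition expC (z : C) : C :=
  (expR (complex.Re z))%:C * ((cos (complex.Im z)) +i* (sin (complex.Im z))).

Definition cabs (z : C) : R := Num.sqrt (complex.Re z ^+ 2 + complex.Im z ^+ 2).

Definition norm2 (y : RR) : R := Num.sqrt (y.1 ^+ 2 + y.2 ^+ 2).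
Definition normC2 (z : C * C) : R :=
  Num.sqrt (cabs z.1 ^+ 2 + cabs z.2 ^+ 2).

Definition cint d (T : measurableType d) (mu : {measure set T -> \bar R})
  (D : set T) (f : T -> C) : C :=
  (Rintegral mu D (fun x => complex.Re (f x))) +i* (Rintegral mu D (fun x => complex.Im (f x))).

(* a complex Borel measure on R^2, given through (Jordan) decompositions
   of its real and imaginary parts into finite positive Borel measures:
   mu = (cm_rp - cm_rn) + i (cm_ip - cm_in) *)
Record cmeasure := CMeasure {
  cm_rp : {finite_measure set RR -> \bar R};
  cm_rn : {finite_measure set RR -> \bar R};
  cm_ip : {finite_measure set RR -> \bar R};
  cm_in : {finite_measure set RR -> \bar R} }.

Definition cmint (mu : cmeasure) (D : set RR) (f : RR -> C) : C :=
  (cint (cm_rp mu) D f - cint (cm_rn mu) D f)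
  + 'i * (cint (cm_ip mu) D f - cint (cm_in mu) D f).

Definition cball (k0 : R) : set RR := [set k | norm2 k <= k0].

Definition pwave (k : RR) (z : C * C) : C :=
  expC ('i * (k.1%:C * z.1 + k.2%:C * z.2)).

Definition Fmu (k0 : R) (mu : nat -> cmeasure) (n : nat) (z : C * C) : C :=
  cmint (mu n) (cball k0) (fun k => pwave k z).

Definition Omega : set RR := [set y | ~ (y.1 = 0 /\ y.2 <= 0)].

(* the polar angle in (-pi/2, 3pi/2) of a point of Omega *)
Definition angle (y : RR) : R :=
  if 0 < y.1 then atan (y.2 / y.1)
  else if y.1 < 0 then pi + atan (y.2 / y.1)
  else pi / 2.

(* principal square root of i t for t > 0: sqrt(t/2) (1 + i) *)
Definition sqrt_it (t : R) : C := (Num.sqrt (t / 2)) +i* (Num.sqrt (t / 2)).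

Definition Lambda (z : C) : C :=
  (2 / Num.sqrt pi)%:C *
  cint (@lebesgue_measure R) `[0%R, +oo[
       (fun s => expC (- (s ^+ 2)%:C - 2%:R * z * s%:C)).

Inductive bc := Dirichlet | Neumann.
Definition bc_sign (b : bc) : C := if b is Dirichlet then -1 else 1.

Definition Green (b : bc) (t : R) (x y : RR) : C :=
  let r := norm2 x in let phi := angle x in
  let rho := norm2 y in let theta := angle y in
  expC (- ((r + rho) ^+ 2)%:C / (4%:R * 'i * t%:C))
  / (8%:R * 'i * pi%:C * t%:C)
  * (Lambda ((Num.sqrt (r * rho) * cos ((phi - theta) / 2))%:C / sqrt_it t)
     + bc_sign b *
       Lambda (- (Num.sqrt (r * rho) * sin ((phi + theta) / 2))%:C / sqrt_it t)).

Definition leb2 := ((@lebesgue_measure R) \x (@lebesgue_measure R))%E.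

Definition Psi_eps (b : bc) (F : C * C -> C) (t : R) (x : RR) (eps : R) : C :=
  cint leb2 Omega
    (fun y => (expR (- eps * norm2 y ^+ 2))%:C * Green b t x y * F (y.1%:C, y.2%:C)).

Definition Psi (b : bc) (F : C * C -> C) (t : R) (x : RR) : C :=
  (lim ((fun eps => complex.Re (Psi_eps b F t x eps)) @ at_right 0%R))
  +i* (lim ((fun eps => complex.Im (Psi_eps b F t x eps)) @ at_right 0%R)).

Definition cvgA1 (Fn : nat -> C * C -> C) (F0 : C * C -> C) : Prop :=
  exists B : R, 0 <= B /\
    forall e : R, 0 < e -> exists N : nat, forall n, (N <= n)%N ->
      forall z : C * C, cabs (Fn n z - F0 z) * expR (- B * normC2 z) <= e.

End Defs.

(* Main.v *)
Require Import Defs.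
From HB Require Import structures.
From mathcomp Require Import all_boot all_order all_algebra.
From mathcomp Require Import all_classical all_reals all_analysis.
From mathcomp Require Import complex measurable_realfun.
From mathcomp Require Import ring lra.
Import Order.TTheory GRing.Theory Num.Theory.
Import numFieldNormedType.Exports.
Local Open Scope classical_set_scope.
Local Open Scope ring_scope.
Local Open Scope complex_scope.
Set Implicit Arguments.
Unset Strict Implicit.
Unset Printing Implicit Defensive.

(* Write a point [y] of the plane as [(u, u m)] and replace the special function
   Lambda by its integral in [s]. For fixed [m], [s] and sign of [u], the integrand
   of [Psi_eps] with [F] a plane wave is then [|u|] times the exponential of a
   polynomial of degree 4 in [sqrt |u|], so that by Cauchy's theorem the half-line
   of integration may be rotated in the direction of [(1 + i / 4) ^ 2]. There
   the Fresnel factor [expC (i |y| ^ 2 / 4 t)] becomes a Gaussian, and the integral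
   converges absolutely, uniformly in [eps >= 0], even against functions of
   exponential growth. Fubini's theorem extends the rotated formula from plane waves
   to their superpositions [Fmu]; dominated convergence then lets [eps] tend to [0].
   In the resulting absolutely convergent integral over the rotated plane,
   which is contained in [C ^ 2], both the exchange with [mu n] and the continuity
   with respect to the convergence in [A_1] are immediate. *)

(** * Complex-valued functions *)

(** The angle answers two demands on [lam ^ 4], where [lam = 1 + i tau] and [tau] runs from [0] to
    [1 / 4]. Its imaginary part makes the Fresnel factor decay; its real part must stay positive, or
    else the regulariser [exp (- eps |y| ^ 2)] would grow during the rotation. At [tau = 0] only the
    regulariser decays, so the contour is moved at fixed [eps > 0]; at [tau = 1 / 4] the Fresnel
    factor decays at a rate free of [eps]. Lambda is opened because its growth depends on the
    direction of its argument. Under the integral in [s] it costs at most [exp (c |y|)] times a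
    Gaussian in [s], whatever the direction: the argument grows only like [sqrt |y|], and a linear
    exponent loses against the Gaussian in [|y|]. Slopes are preferred to polar angles because the
    change of variables is then a one-dimensional scaling combined with Fubini, while the angle is
    still constant on each half of a line. Cauchy's theorem itself is used in real form: Green's
    theorem for a closed form in the variables [tau] and [|u|]. *)

Section ComplexNumbers.
Context {R : realType}.
Implicit Types (z w : R[i]) (x y : R).

Lemma ReD z w : complex.Re (z + w) = complex.Re z + complex.Re w.
Proof. by case: z w => ? ? []. Qed.

Lemma ImD z w : complex.Im (z + w) = complex.Im z + complex.Im w.
Proof. by case: z w => ? ? []. Qed.

Lemma ReN z : complex.Re (- z) = - complex.Re z.
Proof. by case: z. Qed.

Lemma ImN z : complex.Im (- z) = - complex.Im z.
Proof. by case: z. Qed.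

Lemma ReM z w : complex.Re (z * w) =
  complex.Re z * complex.Re w - complex.Im z * complex.Im w.
Proof. by case: z w => ? ? []. Qed.

Lemma ImM z w : complex.Im (z * w) =
  complex.Re z * complex.Im w + complex.Im z * complex.Re w.
Proof. by case: z w => ? ? []. Qed.

Lemma complexRI z w : complex.Re z = complex.Re w ->
  complex.Im z = complex.Im w -> z = w.
Proof. by case: z w => ? ? [] ? ? /= -> ->. Qed.

Lemma cabs_normc z : cabs z = ComplexField.Normc.normc z.
Proof. by case: z. Qed.

Lemma cabs_ge0 z : 0 <= cabs z.
Proof. exact: sqrtr_ge0. Qed.

Lemma cabsM z w : cabs (z * w) = cabs z * cabs w.
Proof. by rewrite !cabs_normc ComplexField.Normc.normcM. Qed.

Lemma cabsV z : cabs z^-1 = (cabs z)^-1.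
Proof. by rewrite !cabs_normc ComplexField.Normc.normcV. Qed.

Lemma cabsD z w : cabs (z + w) <= cabs z + cabs w.
Proof. by rewrite !cabs_normc le_normcD. Qed.

Lemma cabsN z : cabs (- z) = cabs z.
Proof. by rewrite !cabs_normc normcN. Qed.

Lemma cabs_real x : cabs x%:C = `|x|.
Proof. by rewrite /cabs /= expr0n/= addr0 sqrtr_sqr. Qed.

Lemma cabs1 : cabs (1 : R[i]) = 1.
Proof. by rewrite (_ : 1 = 1%:C)// cabs_real normr1. Qed.

Lemma imagE : ('i%R : R[i]) = 'i%C.
Proof. by []. Qed.

Lemma cabs_i : cabs ('i%C : R[i]) = 1.
Proof. by rewrite /cabs /= expr0n expr1n/= add0r sqrtr1. Qed.

Lemma cabsX z n : cabs (z ^+ n) = cabs z ^+ n.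
Proof. by elim: n => [|n IH]; rewrite ?expr0 ?cabs1// !exprS cabsM IH. Qed.

Lemma cabs_sqr z : cabs z ^+ 2 = complex.Re z ^+ 2 + complex.Im z ^+ 2.
Proof. by rewrite sqr_sqrtr// addr_ge0// sqr_ge0. Qed.

Lemma normr_Re_le z : `|complex.Re z| <= cabs z.
Proof.
by rewrite -sqrtr_sqr ler_sqrt ?addr_ge0 ?sqr_ge0// lerDl sqr_ge0.
Qed.

Lemma normr_Im_le z : `|complex.Im z| <= cabs z.
Proof.
by rewrite -sqrtr_sqr ler_sqrt ?addr_ge0 ?sqr_ge0// lerDr sqr_ge0.
Qed.

Lemma cabs_le_ReIm z : cabs z <= `|complex.Re z| + `|complex.Im z|.
Proof.
rewrite -(ler_pXn2r (n := 2))// ?nnegrE ?cabs_ge0 ?addr_ge0//.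
rewrite cabs_sqr sqrrD !real_normK ?num_real//.
by rewrite lerD2r lerDl mulrn_wge0// mulr_ge0.
Qed.

Lemma Re_expC z : complex.Re (expC z) = expR (complex.Re z) * cos (complex.Im z).
Proof. by rewrite ReM /= mul0r subr0. Qed.

Lemma Im_expC z : complex.Im (expC z) = expR (complex.Re z) * sin (complex.Im z).
Proof. by rewrite ImM /= mul0r addr0. Qed.

Lemma expCD z w : expC (z + w) = expC z * expC w.
Proof.
apply: complexRI.
  rewrite (Re_expC (z + w)) (ReM (expC z)) !Re_expC !Im_expC ReD ImD expRD cosD.
  by ring.
rewrite (Im_expC (z + w)) (ImM (expC z)) !Re_expC !Im_expC ReD ImD expRD sinD.
by ring.
Qed.

Lemma cabs_expC z : cabs (expC z) = expR (complex.Re z).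
Proof.
rewrite cabsM cabs_real ger0_norm ?expR_ge0// /cabs /= cos2Dsin2 sqrtr1.
by rewrite mulr1.
Qed.

Lemma expC_real x : expC x%:C = (expR x)%:C.
Proof. by rewrite /expC /= cos0 sin0; apply: complexRI => /=; ring. Qed.

Lemma normr_ReM_le z w : `|complex.Re (z * w)| <= cabs z * cabs w.
Proof. by rewrite -cabsM normr_Re_le. Qed.

End ComplexNumbers.

Section ComplexMeasurable.
Context {R : realType} d {T : measurableType d}.
Implicit Types f g : T -> R[i].

Definition cmeasurable f :=
  measurable_fun setT (fun t => complex.Re (f t)) /\
  measurable_fun setT (fun t => complex.Im (f t)).

Lemma cmeasurable_cst (c : R[i]) : cmeasurable (fun=> c).
Proof. by split; exact: measurable_cst. Qed.

Lemma cmeasurable_real (f : T -> R) : measurable_fun setT f ->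
  cmeasurable (fun t => (f t)%:C).
Proof. by move=> mf; split => //=; exact: measurable_cst. Qed.

Lemma cmeasurableD f g : cmeasurable f -> cmeasurable g ->
  cmeasurable (fun t => f t + g t).
Proof.
move=> [f1 f2] [g1 g2]; split.
  by under eq_fun do rewrite ReD; exact: measurable_funD.
by under eq_fun do rewrite ImD; exact: measurable_funD.
Qed.

Lemma cmeasurableN f : cmeasurable f -> cmeasurable (fun t => - f t).
Proof.
move=> [f1 f2]; split.
  by under eq_fun do rewrite ReN; exact: measurableT_comp.
by under eq_fun do rewrite ImN; exact: measurableT_comp.
Qed.

Lemma cmeasurableM f g : cmeasurable f -> cmeasurable g ->
  cmeasurable (fun t => f t * g t).
Proof.
move=> [f1 f2] [g1 g2]; split.
  by under eq_fun do rewrite ReM; apply: measurable_funB; exact: measurable_funM.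
by under eq_fun do rewrite ImM; apply: measurable_funD; exact: measurable_funM.
Qed.

Lemma cmeasurableX f n : cmeasurable f -> cmeasurable (fun t => f t ^+ n).
Proof.
move=> mf; elim: n => [|n IH].
  by under eq_fun do rewrite expr0; exact: cmeasurable_cst.
by under eq_fun do rewrite exprS; exact: cmeasurableM.
Qed.

Lemma measurable_cos (h : T -> R) : measurable_fun setT h ->
  measurable_fun setT (fun t => cos (h t)).
Proof.
move=> mh; apply: (measurableT_comp (f := cos)) => //.
by apply: continuous_measurable_fun; exact: continuous_cos.
Qed.

Lemma measurable_sin (h : T -> R) : measurable_fun setT h ->
  measurable_fun setT (fun t => sin (h t)).
Proof.
move=> mh; apply: (measurableT_comp (f := sin)) => //.
by apply: continuous_measurable_fun; exact: continuous_sin.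
Qed.

Lemma measurable_expR_comp (h : T -> R) : measurable_fun setT h ->
  measurable_fun setT (fun t => expR (h t)).
Proof. by move=> mh; apply: (measurableT_comp (f := expR)). Qed.

Lemma measurable_sqrt_comp (h : T -> R) : measurable_fun setT h ->
  measurable_fun setT (fun t => Num.sqrt (h t)).
Proof.
move=> mh; apply: (measurableT_comp (f := (@Num.sqrt R : R -> R))) => //.
by apply: continuous_measurable_fun; exact: sqrt_continuous.
Qed.

Lemma cmeasurable_expC f : cmeasurable f -> cmeasurable (fun t => expC (f t)).
Proof.
move=> [f1 f2]; split.
  under eq_fun do rewrite Re_expC; apply: measurable_funM.
    exact: measurable_expR_comp.
  exact: measurable_cos.
under eq_fun do rewrite Im_expC; apply: measurable_funM.
  exact: measurable_expR_comp.
exact: measurable_sin.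
Qed.

End ComplexMeasurable.

Lemma cmeasurable_comp {R : realType} d1 d2 (T1 : measurableType d1)
    (T2 : measurableType d2) (h : T1 -> T2) (f : T2 -> R[i]) :
  measurable_fun setT h -> cmeasurable f -> cmeasurable (f \o h).
Proof.
by move=> mh [f1 f2]; split; [exact: (measurableT_comp f1)|exact: (measurableT_comp f2)].
Qed.

Section ComplexIntegral.
Context {R : realType} d {T : measurableType d} (mu : {measure set T -> \bar R}).
Implicit Types (f : T -> R[i]) (g : T -> R).

Definition cintegrable f :=
  mu.-integrable setT (fun t => (complex.Re (f t))%:E) /\
  mu.-integrable setT (fun t => (complex.Im (f t))%:E).

Lemma eq_cint D f1 f2 : (forall t, D t -> f1 t = f2 t) -> cint mu D f1 = cint mu D f2.
Proof.
by move=> f12; congr Complex; apply: eq_Rintegral => t /set_mem Dt; rewrite f12.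
Qed.

Lemma cint_mkcond D f : cint mu D f = cint mu setT (fun t => (\1_D t)%:C * f t).
Proof.
congr Complex; rewrite Rintegral_mkcond; apply: eq_Rintegral => t _;
  rewrite patchE indicE ?ReM ?ImM /=; case: (t \in D) => /=; rewrite ?mul1r ?mul0r ?subr0 ?addr0//.
Qed.

Lemma dominated_integrable (h g : T -> R) : measurable_fun setT h ->
  mu.-integrable setT (EFin \o g) -> (forall t, `|h t| <= g t) ->
  mu.-integrable setT (EFin \o h).
Proof.
move=> mh ig hg; apply: le_integrable ig => //; first exact/measurable_EFinP.
by move=> t _ /=; rewrite lee_fin (le_trans (hg t))// ler_norm.
Qed.

Lemma dominated_cintegrable f g : cmeasurable f ->
  mu.-integrable setT (EFin \o g) -> (forall t, cabs (f t) <= g t) ->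
  cintegrable f.
Proof.
move=> [mf1 mf2] ig fg; split; apply: dominated_integrable ig _ => // t.
  by rewrite (le_trans (normr_Re_le _)).
by rewrite (le_trans (normr_Im_le _)).
Qed.

(** The factor 2 is the price of estimating the real and imaginary parts separately. *)
Lemma cabs_cint_le f g : cmeasurable f ->
  mu.-integrable setT (EFin \o g) -> (forall t, cabs (f t) <= g t) ->
  cabs (cint mu setT f) <= 2 * Rintegral mu setT g.
Proof.
move=> mf ig fg; have [if1 if2] := dominated_cintegrable mf ig fg.
apply: le_trans (cabs_le_ReIm _) _; rewrite mulr_natl mulr2n lerD//=.
  apply: le_trans (le_normr_Rintegral measurableT if1) _; apply: le_Rintegral => //.
    exact: (integrable_norm if1).
  by move=> t _; rewrite (le_trans (normr_Re_le _)).
apply: le_trans (le_normr_Rintegral measurableT if2) _; apply: le_Rintegral => //.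
  exact: (integrable_norm if2).
by move=> t _; rewrite (le_trans (normr_Im_le _)).
Qed.

Lemma cintD f1 f2 : cintegrable f1 -> cintegrable f2 ->
  cint mu setT (fun t => f1 t + f2 t) = cint mu setT f1 + cint mu setT f2.
Proof.
move=> [r1 i1] [r2 i2]; apply: complexRI => /=.
  by under eq_Rintegral do rewrite ReD; rewrite RintegralD.
by under eq_Rintegral do rewrite ImD; rewrite RintegralD.
Qed.

Lemma cintN f : cintegrable f -> cint mu setT (fun t => - f t) = - cint mu setT f.
Proof.
move=> [r i]; apply: complexRI; rewrite ?ReN ?ImN /=.
  under eq_Rintegral do rewrite ReN -mulN1r.
  by rewrite RintegralZl// mulN1r.
under eq_Rintegral do rewrite ImN -mulN1r.
by rewrite RintegralZl// mulN1r.
Qed.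

Lemma cintegrableD f1 f2 : cintegrable f1 -> cintegrable f2 ->
  cintegrable (fun t => f1 t + f2 t).
Proof.
move=> [r1 i1] [r2 i2]; split.
  under eq_fun do rewrite ReD EFinD; exact: integrableD.
under eq_fun do rewrite ImD EFinD; exact: integrableD.
Qed.

Lemma cintegrableN f : cintegrable f -> cintegrable (fun t => - f t).
Proof.
move=> [r i]; split.
  under eq_fun do rewrite ReN EFinN; exact: integrableN.
under eq_fun do rewrite ImN EFinN; exact: integrableN.
Qed.

Lemma cintegrableZl (c : R[i]) f : cintegrable f -> cintegrable (fun t => c * f t).
Proof.
move=> [r i]; split.
  under eq_fun do rewrite ReM EFinB !EFinM.
  by apply: integrableB => //; exact: integrableZl.
under eq_fun do rewrite ImM EFinD !EFinM.
by apply: integrableD => //; exact: integrableZl.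
Qed.

Lemma cintB f1 f2 : cintegrable f1 -> cintegrable f2 ->
  cint mu setT (fun t => f1 t - f2 t) = cint mu setT f1 - cint mu setT f2.
Proof.
by move=> i1 i2; rewrite -(cintN i2) -cintD//; exact: cintegrableN.
Qed.

Lemma cintZl (c : R[i]) f : cintegrable f ->
  cint mu setT (fun t => c * f t) = c * cint mu setT f.
Proof.
have iZ (r : R) (h : T -> R) : mu.-integrable setT (EFin \o h) ->
    mu.-integrable setT (EFin \o (fun t => r * h t)).
  by move=> ih; rewrite /comp; under eq_fun do rewrite EFinM; exact: integrableZl.
move=> [r i]; apply: complexRI; rewrite ?ReM ?ImM /=.
  under eq_Rintegral do rewrite ReM.
  by rewrite RintegralB ?RintegralZl//; exact: iZ.
under eq_Rintegral do rewrite ImM.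
by rewrite RintegralD ?RintegralZl//; exact: iZ.
Qed.

End ComplexIntegral.

Section ComplexDominatedConvergence.
Context {R : realType} d {T : measurableType d} (mu : {measure set T -> \bar R}).

Lemma Rintegral_cvg (f_ : nat -> T -> R) (f g : T -> R) :
  (forall n, measurable_fun setT (f_ n)) -> measurable_fun setT f ->
  (forall t, f_ n t @[n --> \oo] --> f t) ->
  mu.-integrable setT (EFin \o g) -> (forall n t, `|f_ n t| <= g t) ->
  Rintegral mu setT (f_ n) @[n --> \oo] --> Rintegral mu setT f.
Proof.
move=> mf_ mf ff ig fg.
have [| | | | |iF _ F] := @dominated_convergence _ T R mu setT measurableT
  (fun n t => (f_ n t)%:E) (EFin \o f) (EFin \o g).
- by move=> n; exact/measurable_EFinP.
- exact/measurable_EFinP.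
- by apply: aeW => t _; apply: cvg_EFin; [exact: nearW|exact: ff].
- exact: ig.
- by apply: aeW => t n _; rewrite lee_fin fg.
apply: fine_cvg; rewrite /Rintegral fineK//.
exact: integrable_fin_num iF.
Qed.

(** A limit at [0^'+] may be tested on sequences of positive numbers tending to 0, which reduces the
    claim to dominated convergence for sequences. *)
Lemma cint_at_right_cvg (f_ : R -> T -> R[i]) (f : T -> R[i]) (g : T -> R) :
  (forall e, 0 <= e -> cmeasurable (f_ e)) -> cmeasurable f ->
  (forall t, complex.Re (f_ e t) @[e --> 0^'+] --> complex.Re (f t)) ->
  (forall t, complex.Im (f_ e t) @[e --> 0^'+] --> complex.Im (f t)) ->
  mu.-integrable setT (EFin \o g) ->
  (forall e t, 0 <= e -> cabs (f_ e t) <= g t) ->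
  (complex.Re (cint mu setT (f_ e)) @[e --> 0^'+] --> complex.Re (cint mu setT f)) /\
  (complex.Im (cint mu setT (f_ e)) @[e --> 0^'+] --> complex.Im (cint mu setT f)).
Proof.
move=> mf_ [mf1 mf2] ff1 ff2 ig fg; split; apply/cvg_at_rightP => u [u0 cu] /=.
  apply: Rintegral_cvg (ig) _ => //.
  - by move=> n; case: (mf_ (u n) (ltW (u0 n))).
  - by move=> t; move/cvg_at_rightP: (ff1 t); apply.
  - by move=> n t; rewrite (le_trans (normr_Re_le _))// fg// ltW.
apply: Rintegral_cvg (ig) _ => //.
- by move=> n; case: (mf_ (u n) (ltW (u0 n))).
- by move=> t; move/cvg_at_rightP: (ff2 t); apply.
- by move=> n t; rewrite (le_trans (normr_Im_le _))// fg// ltW.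
Qed.

End ComplexDominatedConvergence.

Section ComplexFubini.
Context {R : realType} d1 d2 {T1 : measurableType d1} {T2 : measurableType d2}.
Variables (m1 : {sigma_finite_measure set T1 -> \bar R})
          (m2 : {sigma_finite_measure set T2 -> \bar R}).
Local Open Scope ereal_scope.

(** This holds without integrability: the extended integral is a difference of two functions that
    are measurable by Tonelli, and [fine] is measurable. *)
Lemma measurable_Rintegral2 (f : T1 * T2 -> R) : measurable_fun setT f ->
  measurable_fun setT (fun x => Rintegral m2 setT (fun y => f (x, y))).
Proof.
move=> mf; apply: measurableT_comp; first exact: fine_measurable.
under eq_fun do rewrite integralE.
apply: emeasurable_funB.
  rewrite [X in measurable_fun _ X](_ : _ = fubini_F m2 (EFin \o f)^\+); last first.
    by apply/funext => x; apply: eq_integral => y _; rewrite !funeposE.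
  by apply: measurable_fun_fubini_tonelli_F => //; exact/measurable_funepos/measurable_EFinP.
rewrite [X in measurable_fun _ X](_ : _ = fubini_F m2 (EFin \o f)^\-); last first.
  by apply/funext => x; apply: eq_integral => y _; rewrite !funenegE.
by apply: measurable_fun_fubini_tonelli_F => //; exact/measurable_funeneg/measurable_EFinP.
Qed.

Lemma Rintegral12 (f : T1 * T2 -> R) : (m1 \x m2).-integrable setT (EFin \o f) ->
  Rintegral m1 setT (fun x => Rintegral m2 setT (fun y => f (x, y))) =
  Rintegral (m1 \x m2) setT f.
Proof.
move=> intf; rewrite /Rintegral -(integral12_prod_meas1 intf); congr fine.
apply: ae_eq_integral => //.
- apply/measurable_EFinP; apply: measurable_Rintegral2.
  by apply/measurable_EFinP; case/integrableP: intf.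
- by have /integrableP[] := integrable_fubini_F intf.
(* The inner integral is known to be finite only for almost every [x]; on the exceptional null set
   [fine] may alter its value. *)
apply: filterS (ae_integrable1 intf) => x ifx _.
by rewrite /fubini_F /= fineK//; exact: integrable_fin_num ifx.
Qed.

Lemma Rintegral21 (f : T1 * T2 -> R) : (m1 \x m2).-integrable setT (EFin \o f) ->
  Rintegral m2 setT (fun y => Rintegral m1 setT (fun x => f (x, y))) =
  Rintegral (m1 \x m2) setT f.
Proof.
move=> intf; rewrite /Rintegral -(integral21_prod_meas1 intf); congr fine.
apply: ae_eq_integral => //.
- apply/measurable_EFinP; apply: measurableT_comp; first exact: fine_measurable.
  exact: measurable_fubini_G intf.
- exact: measurable_fubini_G intf.
apply: filterS (ae_integrable2 intf) => x ifx _.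
by rewrite /fubini_G /= fineK//; exact: integrable_fin_num ifx.
Qed.

Lemma cmeasurable_cint (f : T1 * T2 -> R[i]) : cmeasurable f ->
  cmeasurable (fun x => cint m2 setT (fun y => f (x, y))).
Proof.
move=> [f1 f2]; split.
  exact: (measurable_Rintegral2 (f := fun z => complex.Re (f z))).
exact: (measurable_Rintegral2 (f := fun z => complex.Im (f z))).
Qed.

Lemma cint12 (f : T1 * T2 -> R[i]) : cintegrable (m1 \x m2) f ->
  cint m1 setT (fun x => cint m2 setT (fun y => f (x, y))) = cint (m1 \x m2) setT f.
Proof. by move=> [f1 f2]; congr Complex; [exact: (Rintegral12 f1)|exact: (Rintegral12 f2)]. Qed.

Lemma cint21 (f : T1 * T2 -> R[i]) : cintegrable (m1 \x m2) f ->
  cint m2 setT (fun y => cint m1 setT (fun x => f (x, y))) = cint (m1 \x m2) setT f.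
Proof. by move=> [f1 f2]; congr Complex; [exact: (Rintegral21 f1)|exact: (Rintegral21 f2)]. Qed.

End ComplexFubini.

Section ProductDomination.
Context {R : realType} d1 d2 {T1 : measurableType d1} {T2 : measurableType d2}.
Variables (m1 : {sigma_finite_measure set T1 -> \bar R})
          (m2 : {sigma_finite_measure set T2 -> \bar R}).
Local Open Scope ereal_scope.

Lemma integrable_prod (g1 : T1 -> R) (g2 : T2 -> R) :
  (forall x, (0 <= g1 x)%R) -> (forall y, (0 <= g2 y)%R) ->
  m1.-integrable setT (EFin \o g1) -> m2.-integrable setT (EFin \o g2) ->
  (m1 \x m2).-integrable setT (fun z => (g1 z.1 * g2 z.2)%:E).
Proof.
move=> g10 g20 i1 i2.
have m1' : measurable_fun setT g1 by case/integrableP: i1 => /measurable_EFinP.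
have m2' : measurable_fun setT g2 by case/integrableP: i2 => /measurable_EFinP.
apply/integrable12ltyP.
  apply/measurable_EFinP; apply: measurable_funM; exact: measurableT_comp.
rewrite (_ : (fun _ => _) = fun x => (g1 x)%:E * \int[m2]_y (g2 y)%:E); last first.
  apply/funext => x /=; rewrite -ge0_integralZl//=.
  - by apply: eq_integral => y _; rewrite -EFinM ger0_norm// mulr_ge0.
  - exact/measurable_EFinP.
  - by move=> y _; rewrite lee_fin.
  - by rewrite lee_fin.
rewrite ge0_integralZr//=.
- by rewrite lte_mul_pinfty//; [apply: integral_ge0 => x _; rewrite lee_fin|
    exact: integrable_fin_num i1|exact: integrable_lty i2].
- exact/measurable_EFinP.
- by move=> x _; rewrite lee_fin.
- by apply: integral_ge0 => y _; rewrite lee_fin.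
Qed.

End ProductDomination.

(** * Ray coordinates *)

Section Scaling.
Context {R : realType}.
Local Notation leb := (@lebesgue_measure R).
Local Open Scope ereal_scope.

(** Lebesgue measure is determined by the lengths of half-open intervals, and the pushforward under
    the scaling, multiplied by [c], gives them the right length. *)
Lemma lebesgue_measureZ (c : R) (c0 : (0 < c)%R) (A : set R) : measurable A ->
  leb A = c%:E * leb ((fun m : R => (c * m)%R) @^-1` A).
Proof.
move=> mA.
have mc : measurable_fun setT (fun m : measurableTypeR R => (c * m)%R : measurableTypeR R).
  exact: mulrl_measurable.
pose nu : {measure set measurableTypeR R -> \bar R} :=
  measure_function_pushforward__canonical__measure_function_Measure leb mc.
have := @lebesgue_measure_unique R
  (mscale (NngNum (ltW c0)) nu).
apply => // _ [[a b]] _ <-.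
rewrite /= /mscale /= /pushforward.
rewrite (_ : _ @^-1` _ = `](c^-1 * a)%R, (c^-1 * b)%R]%classic); last first.
  by apply/seteqP; split => x /=; rewrite !in_itv/= ltr_pdivrMl// ler_pdivlMl.
rewrite !lebesgue_measure_itv/= !lte_fin ltr_pM2l ?invr_gt0//.
case: ifPn => _; last by rewrite mule0.
by rewrite -!EFinB -EFinM -mulrBr mulrA divff ?gt_eqF// mul1r.
Qed.

Lemma ge0_integral_scale_gt0 (c : R) (f : R -> \bar R) : (0 < c)%R ->
  measurable_fun setT f -> (forall x, 0 <= f x) ->
  \int[leb]_x f x = \int[leb]_m (f (c * m)%R * c%:E).
Proof.
move=> c0 mf f0.
have mc : measurable_fun setT (fun m : measurableTypeR R => (c * m)%R : measurableTypeR R).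
  exact: mulrl_measurable.
pose nu : {measure set measurableTypeR R -> \bar R} :=
  measure_function_pushforward__canonical__measure_function_Measure leb mc.
transitivity (\int[mscale (NngNum (ltW c0)) nu]_x f x).
  by apply: eq_measure_integral => A mA _; exact: lebesgue_measureZ.
rewrite ge0_integral_mscale//= (ge0_integral_pushforward mc)//= muleC ge0_integralZr//.
- exact: measurableT_comp.
- by rewrite lee_fin ltW.
Qed.

Lemma ge0_integral_oppr (f : R -> \bar R) :
  measurable_fun setT f -> (forall x, 0 <= f x) ->
  \int[leb]_x f x = \int[leb]_x f (- x)%R.
Proof.
move=> mf f0.
transitivity (\int[pushforward leb (-%R : _ -> measurableTypeR R)]_x f x).
  by apply: eq_measure_integral => A mA _; exact/esym/lebesgue_measureN.
by rewrite ge0_integral_pushforward.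
Qed.

Lemma ge0_integral_scale (c : R) (f : R -> \bar R) : (c != 0)%R ->
  measurable_fun setT f -> (forall x, 0 <= f x) ->
  \int[leb]_x f x = \int[leb]_m (f (c * m)%R * `|c|%R%:E).
Proof.
move=> c_neq0 mf f0; have [c0|c0|c0] := ltgtP c 0%R; last by rewrite c0 eqxx in c_neq0.
  rewrite ltr0_norm// ge0_integral_oppr//.
  rewrite (@ge0_integral_scale_gt0 (- c))//= ?oppr_gt0//.
  - by apply: eq_integral => x _; rewrite mulNr opprK.
  - exact: measurableT_comp.
by rewrite gtr0_norm//; exact: ge0_integral_scale_gt0.
Qed.

End Scaling.

Section RayCoordinates.
Context {R : realType}.
Local Notation leb := (@lebesgue_measure R).
Local Open Scope ereal_scope.

Lemma measurable_ray : measurable_fun setT (fun z : R * R => (z.1, (z.1 * z.2)%R)).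
Proof. by apply: measurable_fun_pair => //; exact: measurable_funM. Qed.

(* Instead of polar coordinates, the rays [m |-> (u, u m)] are parametrised by
   their slope; the line [y.1 = 0] that they miss is negligible. *)
Lemma ge0_integral_ray (f : R * R -> \bar R) :
  measurable_fun setT f -> (forall x, 0 <= f x) ->
  \int[leb \x leb]_y f y = \int[leb \x leb]_z (f (z.1, (z.1 * z.2)%R) * `|z.1|%R%:E).
Proof.
move=> mf f0; rewrite !fubini_tonelli1//; last 2 first.
- apply: emeasurable_funM; first exact: (measurableT_comp mf measurable_ray).
  by apply/measurable_EFinP; exact: measurableT_comp.
- by move=> z; rewrite mule_ge0// lee_fin.
apply: ae_eq_integral => //.
- by apply: measurable_fun_fubini_tonelli_F.
- apply: (measurable_fun_fubini_tonelli_F (m2 := leb)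
    (fun z : R * R => f (z.1, (z.1 * z.2)%R) * `|z.1|%R%:E)).
    apply: emeasurable_funM; first exact: (measurableT_comp mf measurable_ray).
    by apply/measurable_EFinP; exact: measurableT_comp.
  by move=> z; rewrite mule_ge0// lee_fin.
exists [set 0%R]; split => //; first exact: lebesgue_measure_set1.
move=> u /= /not_implyP[_]; apply: contra_notP => /eqP u0.
rewrite /fubini_F/= (@ge0_integral_scale _ u (fun y => f (u, y)))//.
by apply: measurableT_comp => //; exact: measurable_pair1.
Qed.

(** Positive and negative parts are transformed separately, so that measurability suffices. The
    coordinates can therefore be changed in [Psi_eps] before any bound on the Green's function is
    known. *)
Lemma integral_ray (f : R * R -> R) : measurable_fun setT f ->
  \int[leb \x leb]_y (f y)%:E =
  \int[leb \x leb]_z (f (z.1, (z.1 * z.2)%R) * `|z.1|)%:E.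
Proof.
move=> mf; rewrite integralE [RHS]integralE.
congr (_ - _).
  rewrite ge0_integral_ray//; last exact/measurable_funepos/measurable_EFinP.
  by apply: eq_integral => z _; rewrite !funeposE EFinM maxe_pMl// mul0e.
rewrite ge0_integral_ray//; last exact/measurable_funeneg/measurable_EFinP.
by apply: eq_integral => z _; rewrite !funenegE EFinM -mulNe maxe_pMl// mul0e.
Qed.

Lemma integrable_ray (f : R * R -> R) : measurable_fun setT f ->
  (leb \x leb).-integrable setT (EFin \o f) ->
  (leb \x leb).-integrable setT (fun z => (f (z.1, (z.1 * z.2)%R) * `|z.1|)%:E).
Proof.
move=> mf /integrableP[_ foo]; apply/integrableP; split.
  apply/measurable_EFinP; apply: measurable_funM.
    exact: (measurableT_comp mf measurable_ray).
  exact: measurableT_comp.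
move: foo; rewrite (@ge0_integral_ray (fun y => `|(f y)%:E|))//; last first.
  by apply: measurableT_comp => //; exact/measurable_EFinP.
apply: le_lt_trans; rewrite le_eqVlt; apply/orP; left; apply/eqP.
by apply: eq_integral => z _; rewrite EFinM abseM; congr (_ * _); rewrite /= normr_id.
Qed.

End RayCoordinates.

Section SigmaFiniteProduct.
Context d1 d2 {T1 : measurableType d1} {T2 : measurableType d2} {R : realType}.
Variables (m1 : {sigma_finite_measure set T1 -> \bar R})
          (m2 : {sigma_finite_measure set T2 -> \bar R}).

Lemma product_sigma_finite : sigma_finite setT (m1 \x m2)%E.
Proof.
have /sigma_finiteP[F [FT Fnd Ffin]] := sigma_finiteT m1.
have /sigma_finiteP[G [GT Gnd Gfin]] := sigma_finiteT m2.
exists (fun n => F n `*` G n) => [|n].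
  apply/esym; rewrite -subTset => -[u v] _.
  have [i _ Fu] : (\bigcup_n F n) u by rewrite -FT.
  have [j _ Gv] : (\bigcup_n G n) v by rewrite -GT.
  exists (maxn i j) => //; split => /=.
    by have /subsetPset := Fnd _ _ (leq_maxl i j); apply.
  by have /subsetPset := Gnd _ _ (leq_maxr i j); apply.
have [mF F_fin] := Ffin n; have [mG G_fin] := Gfin n.
split; first exact: measurableX.
by rewrite product_measure1E// lte_mul_pinfty// ge0_fin_numE.
Qed.

End SigmaFiniteProduct.

Section LebesguePlane.
Context {R : realType}.
Local Notation leb := (@lebesgue_measure R).

(* Canonical inference does not find the sigma-finiteness of a product [\x] of
   sigma-finite measures, hence instances on named constants. *)
HB.instance Definition _ := Measure.copy (@leb2 R) (leb \x leb)%E.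
HB.instance Definition _ :=
  Measure_isSigmaFinite.Build _ _ _ (@leb2 R) (product_sigma_finite leb leb).

Definition leb3 := (@leb2 R \x leb)%E.

HB.instance Definition _ := Measure.copy leb3 (@leb2 R \x leb)%E.
HB.instance Definition _ :=
  Measure_isSigmaFinite.Build _ _ _ leb3 (product_sigma_finite (@leb2 R) leb).

End LebesguePlane.

(** * Rotation of a half-line *)

Section RealRectangle.
Context {R : realType}.
Local Notation leb := (@lebesgue_measure R).

Lemma derivable_FTC2 (F f : R -> R) (a b : R) : a < b ->
  (forall x, a <= x <= b -> is_derive x 1 F (f x)) ->
  (forall x, a <= x <= b -> {for x, continuous f}) ->
  (\int[leb]_(x in `[a, b]) (f x)%:E = (F b - F a)%:E)%E.
Proof.
move=> ab dF cf.
have cF x : a <= x <= b -> {for x, continuous F}.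
  move=> xab; apply: differentiable_continuous; apply/derivable1_diffP.
  by have [] := dF _ xab.
rewrite (@continuous_FTC2 _ f F)// ?EFinB//.
- apply: continuous_in_subspaceT => x; rewrite inE/= in_itv/= => xab.
  exact: cf.
- split.
  + move=> x; rewrite in_itv/= => /andP[ax xb].
    by have [] := dF x; rewrite ?(ltW ax) ?(ltW xb).
  + by apply: cvg_at_right_filter; apply: cF; rewrite lexx ltW.
  + by apply: cvg_at_left_filter; apply: cF; rewrite lexx ltW.
move=> x; rewrite in_itv/= => /andP[ax xb].
have [|_ <-] := dF x; first by rewrite (ltW ax) (ltW xb).
by rewrite derive1E.
Qed.

(* Green's theorem on [[0, T] x [a, b]] for a closed form [u ds + v dt]. *)
Lemma rectangle_integral (u v w : R -> R -> R) (T a b M : R) : 0 < T -> a < b ->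
  (forall t s : R, 0 <= t <= T -> a <= s <= b -> is_derive t 1 (u^~ s) (w t s)) ->
  (forall t s : R, 0 <= t <= T -> a <= s <= b -> is_derive s 1 (v t) (w t s)) ->
  (forall t s : R, 0 <= t <= T -> a <= s <= b -> {for t, continuous (w^~ s)}) ->
  (forall t s : R, 0 <= t <= T -> a <= s <= b -> {for s, continuous (w t)}) ->
  measurable_fun setT (fun z : R * R => w z.1 z.2) ->
  (forall t s : R, 0 <= t <= T -> a <= s <= b -> `|w t s| <= M) ->
  Rintegral leb `[a, b] (fun s => u T s - u 0 s) =
  Rintegral leb `[0, T] (fun t => v t b - v t a).
Proof.
move=> T0 ab du dv cwt cws mw wM.
have M0 : 0 <= M by apply: le_trans (wM 0 a _ _) => //; rewrite lexx ltW.
(* Both sides are iterated integrals of this cut-off function: the fundamental theorem of calculus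
   is applied in [t] on the left and in [s] on the right. The bound [M] makes it integrable on the
   plane, so Fubini identifies them. *)
pose F (z : R * R) := \1_(`[0, T]%classic : set R) z.1 *
  (\1_(`[a, b]%classic : set R) z.2) * w z.1 z.2.
have mF : measurable_fun setT F.
  apply: measurable_funM => //; apply: measurable_funM.
    by apply: measurableT_comp => //; exact: measurable_indic.
  by apply: measurableT_comp => //; exact: measurable_indic.
have iF : (leb \x leb)%E.-integrable setT (EFin \o F).
  apply: (@dominated_integrable R _ _ (leb \x leb)%E F
    (fun z => (M * \1_(`[0, T]%classic : set R) z.1) * \1_(`[a, b]%classic : set R) z.2)) => //.
    apply: (@integrable_prod R _ _ _ _ leb leb
      (fun t => M * \1_(`[0, T]%classic : set R) t) (\1_(`[a, b]%classic : set R))).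
    - by move=> x; rewrite mulr_ge0// indicE.
    - by move=> x; rewrite indicE.
    - rewrite /comp; under eq_fun do rewrite EFinM.
      by apply: integrableZl => //; exact: integrable_indic_itv.
    - exact: integrable_indic_itv.
  move=> z; rewrite /F !indicE/= !normrM.
  have [zT|_] := boolP (z.1 \in _); last by rewrite !(mul0r, mulr0, normr0).
  have [zb|_] := boolP (z.2 \in _); last by rewrite !(mul0r, mulr0, normr0).
  rewrite !normr1 !mul1r !mulr1; apply: wM; first by move: zT; rewrite inE/= in_itv.
  by move: zb; rewrite inE/= in_itv.
rewrite /Rintegral; congr fine.
transitivity (\int[leb]_s \int[leb]_t (F (t, s))%:E)%E.
  rewrite integral_mkcond; apply: eq_integral => s _; rewrite patchE.
  case: ifPn => sab; last first.
    rewrite integral0_eq// => t _.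
    by rewrite /F/= [X in _ * X * _]indicE (negbTE sab) mulr0 mul0r.
  have sab' : a <= s <= b by move: sab; rewrite inE/= in_itv.
  have -> : (u T s - u 0 s)%:E = (\int[leb]_(t in `[0%R, T]) (w t s)%:E)%E.
    apply/esym/(@derivable_FTC2 (u^~ s) (w^~ s)) => // t t0T;
      [exact: du t s t0T sab'|exact: cwt t s t0T sab'].
  rewrite integral_mkcond; apply: eq_integral => t _; rewrite patchE /F/=.
  rewrite [X in _ * X * _]indicE sab mulr1 indicE.
  by case: ifPn => _; rewrite ?mul1r ?mul0r.
rewrite -(Fubini iF) integral_mkcond; apply: eq_integral => t _; rewrite patchE.
case: ifPn => tT; last first.
  rewrite integral0_eq// => s _.
  by rewrite /F/= [X in X * _ * _]indicE (negbTE tT) !mul0r.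
have tT' : 0 <= t <= T by move: tT; rewrite inE/= in_itv.
have := @derivable_FTC2 (v t) (w t) a b ab (fun s => dv t s tT') (fun s => cws t s tT').
move=> <-.
rewrite [RHS]integral_mkcond; apply: eq_integral => s _; rewrite patchE /F/=.
rewrite [X in X * _ * _]indicE tT mul1r indicE.
by case: ifPn => _; rewrite ?mul1r ?mul0r.
Qed.

End RealRectangle.

Section ComplexDerivative.
Context {R : realType}.
Implicit Types (f g : R -> R[i]) (x : R).

Definition is_cderive x f (d : R[i]) :=
  is_derive x 1 (fun t => complex.Re (f t)) (complex.Re d) /\
  is_derive x 1 (fun t => complex.Im (f t)) (complex.Im d).

Lemma is_derive_idfun x : is_derive x 1 (fun t : R => t) 1.
Proof. exact: is_derive_id. Qed.

Lemma is_cderive_cst x (c : R[i]) : is_cderive x (fun=> c) 0.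
Proof. by split; exact: is_derive_cst. Qed.

Lemma is_cderive_real x (f : R -> R) d : is_derive x 1 f d ->
  is_cderive x (fun t => (f t)%:C) d%:C.
Proof. by move=> df; split => //=; exact: is_derive_cst. Qed.

Lemma is_cderiveD x f g df dg : is_cderive x f df -> is_cderive x g dg ->
  is_cderive x (fun t => f t + g t) (df + dg).
Proof.
move=> [f1 f2] [g1 g2]; split.
  by under eq_fun do rewrite ReD; rewrite ReD; exact: is_deriveD.
by under eq_fun do rewrite ImD; rewrite ImD; exact: is_deriveD.
Qed.

Lemma is_cderiveM x f g df dg : is_cderive x f df -> is_cderive x g dg ->
  is_cderive x (fun t => f t * g t) (df * g x + f x * dg).
Proof.
move=> [f1 f2] [g1 g2]; split.
  under eq_fun do rewrite ReM.
  have := is_deriveB (is_deriveM f1 g1) (is_deriveM f2 g2).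
  move=> /is_derive_eq; apply; rewrite ReD !ReM /GRing.scale/=; ring.
under eq_fun do rewrite ImM.
have := is_deriveD (is_deriveM f1 g2) (is_deriveM f2 g1).
by move=> /is_derive_eq; apply; rewrite ImD !ImM /GRing.scale/=; ring.
Qed.

Lemma is_cderive_expC x f df : is_cderive x f df ->
  is_cderive x (fun t => expC (f t)) (df * expC (f x)).
Proof.
move=> [f1 f2].
have e1 := is_derive1_comp (is_derive_expR (complex.Re (f x))) f1.
have c1 := is_derive1_comp (is_derive_cos (complex.Im (f x))) f2.
have s1 := is_derive1_comp (is_derive_sin (complex.Im (f x))) f2.
split.
  under eq_fun do rewrite Re_expC.
  have := is_deriveM e1 c1.
  move=> /is_derive_eq; apply.
  by rewrite (ReM df) Re_expC Im_expC /GRing.scale/=; ring.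
under eq_fun do rewrite Im_expC.
have := is_deriveM e1 s1.
move=> /is_derive_eq; apply.
by rewrite (ImM df) Re_expC Im_expC /GRing.scale/=; ring.
Qed.

Lemma is_cderive_continuous x f d : is_cderive x f d ->
  {for x, continuous (fun t => complex.Re (f t))} /\
  {for x, continuous (fun t => complex.Im (f t))}.
Proof.
by move=> [[f1 _] [f2 _]]; split; apply: differentiable_continuous;
  exact/derivable1_diffP.
Qed.

Lemma is_cderive_eq x f d d' : is_cderive x f d -> d = d' -> is_cderive x f d'.
Proof. by move=> ? <-. Qed.

(** Serves where only continuity is wanted and the value of the derivative is of no interest. *)
Definition cderivable x f := exists d, is_cderive x f d.

Lemma cderivable_cst x (c : R[i]) : cderivable x (fun=> c).
Proof. by exists 0; exact: is_cderive_cst. Qed.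

Lemma cderivable_real x (f : R -> R) d : is_derive x 1 f d ->
  cderivable x (fun t => (f t)%:C).
Proof. by move=> df; exists d%:C; exact: is_cderive_real. Qed.

Lemma cderivableD x f g : cderivable x f -> cderivable x g ->
  cderivable x (fun t => f t + g t).
Proof. by move=> [df ?] [dg ?]; exists (df + dg); exact: is_cderiveD. Qed.

Lemma cderivableM x f g : cderivable x f -> cderivable x g ->
  cderivable x (fun t => f t * g t).
Proof. by move=> [df ?] [dg ?]; exists (df * g x + f x * dg); exact: is_cderiveM. Qed.

Lemma cderivableX x f n : cderivable x f -> cderivable x (fun t => f t ^+ n).
Proof.
move=> df; elim: n => [|n IH].
  by under eq_fun do rewrite expr0; exact: cderivable_cst.
by under eq_fun do rewrite exprS; exact: cderivableM.
Qed.

Lemma cderivable_expC x f : cderivable x f -> cderivable x (fun t => expC (f t)).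
Proof. by move=> [df ?]; exists (df * expC (f x)); exact: is_cderive_expC. Qed.

End ComplexDerivative.

Section ComplexBounded.
Context {R : realType} {T : Type} (S : set T).
Implicit Types f g : T -> R[i].

Definition cbounded f := exists M : R, forall t, S t -> cabs (f t) <= M.

Lemma cbounded_cst (c : R[i]) : cbounded (fun=> c).
Proof. by exists (cabs c). Qed.

Lemma cbounded_real (f : T -> R) M : (forall t, S t -> `|f t| <= M) ->
  cbounded (fun t => (f t)%:C).
Proof. by move=> fM; exists M => t St; rewrite cabs_real fM. Qed.

Lemma cboundedD f g : cbounded f -> cbounded g -> cbounded (fun t => f t + g t).
Proof.
move=> [M fM] [N gN]; exists (M + N) => t St.
by rewrite (le_trans (cabsD _ _))// lerD ?fM ?gN.
Qed.

Lemma cboundedM f g : cbounded f -> cbounded g -> cbounded (fun t => f t * g t).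
Proof.
move=> [M fM] [N gN]; exists (M * N) => t St.
by rewrite cabsM ler_pM ?cabs_ge0 ?fM ?gN.
Qed.

Lemma cboundedX f n : cbounded f -> cbounded (fun t => f t ^+ n).
Proof.
move=> bf; elim: n => [|n IH].
  by under eq_fun do rewrite expr0; exact: cbounded_cst.
by under eq_fun do rewrite exprS; exact: cboundedM.
Qed.

Lemma cbounded_expC f : cbounded f -> cbounded (fun t => expC (f t)).
Proof.
move=> [M fM]; exists (expR M) => t St; rewrite cabs_expC ler_expR.
by rewrite (le_trans (ler_norm _))// (le_trans (normr_Re_le _))// fM.
Qed.

End ComplexBounded.

(** * Gaussian majorants and exhaustion of the half-line *)

Section Gaussian.
Context {R : realType}.
Local Notation leb := (@lebesgue_measure R).

Lemma measurable_gaussian (c : R) : measurable_fun setT (fun x : R => expR (- c * x ^+ 2)).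
Proof. by apply: measurable_expR_comp; apply: measurable_funM => //; exact: measurable_funX. Qed.

Lemma integrable_gaussian (c : R) : 0 < c ->
  leb.-integrable setT (fun x => (expR (- c * x ^+ 2))%:E).
Proof.
move=> c0; apply/integrableP; split; first by apply/measurable_EFinP; exact: measurable_gaussian.
under eq_integral do rewrite abse_EFin ger0_norm ?expR_ge0//.
have sc0 : 0 < Num.sqrt c by rewrite sqrtr_gt0.
have := @integralT_gauss R.
rewrite (@ge0_integral_scale _ (Num.sqrt c) (EFin \o gauss_fun)).
- rewrite /= ge0_integralZr//=.
  + under eq_integral do rewrite /gauss_fun exprMn sqr_sqrtr ?ltW// -mulNr.
    move=> /(congr1 (fun z => z * ((Num.sqrt c)^-1)%:E)%E).
    rewrite -muleA -EFinM ger0_norm ?ltW// divff ?gt_eqF// mule1 => ->.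
    by rewrite -EFinM ltry.
  + apply/measurable_EFinP; apply: measurableT_comp; last exact: mulrl_measurable.
    exact: measurable_gauss_fun.
  + by move=> x _; rewrite lee_fin gauss_fun_ge0.
- by rewrite gt_eqF.
- by apply/measurable_EFinP; exact: measurable_gauss_fun.
- by move=> x; rewrite lee_fin gauss_fun_ge0.
Qed.

Lemma sqr_le_expR (c x : R) : 0 < c -> x ^+ 2 <= c^-1 * expR (c * x ^+ 2).
Proof.
move=> c0; rewrite -ler_pdivrMl ?invr_gt0// invrK.
by apply: le_trans (expR_ge1Dx _); rewrite lerDr.
Qed.

Lemma norm_le_expR (c x : R) : 0 < c -> `|x| <= (1 + c^-1) * expR (c * x ^+ 2).
Proof.
move=> c0; have /= := sqr_le_expR x c0; rewrite mulrDl mul1r.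
have : 1 <= expR (c * x ^+ 2) by rewrite -expR0 ler_expR mulr_ge0 ?sqr_ge0// ltW.
have : `|x| <= 1 + x ^+ 2.
  rewrite -(real_normK (num_real x)); move: `|x| => y.
  by have := sqr_ge0 (y - 2^-1); rewrite sqrrB; lra.
lra.
Qed.

Lemma integrable_norm_gaussian (c : R) : 0 < c ->
  leb.-integrable setT (fun x => (`|x| * expR (- c * x ^+ 2))%:E).
Proof.
move=> c0; have c20 : 0 < c / 2 by rewrite divr_gt0.
apply: (@dominated_integrable R _ _ leb (fun x => `|x| * expR (- c * x ^+ 2))
  (fun x => (1 + (c / 2)^-1) * expR (- (c / 2) * x ^+ 2))).
- by apply: measurable_funM => //; exact: measurable_gaussian.
- rewrite /comp; under eq_fun do rewrite EFinM.
  by apply: integrableZl => //; exact: integrable_gaussian.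
- move=> x; rewrite ger0_norm ?mulr_ge0 ?expR_ge0//.
  rewrite (_ : - c * x ^+ 2 = (c / 2) * - x ^+ 2 + - (c / 2) * x ^+ 2); last by field.
  rewrite expRD mulrA ler_pM2r ?expR_gt0// mulrN expRN.
  by rewrite ler_pdivrMr ?expR_gt0// norm_le_expR.
Qed.

(** The truncation stays away from 0, where [sqrt] is not differentiable. The index [n.+2] makes
    every interval nondegenerate: with [n.+1] the first one would be the point 1. *)
Lemma Rintegral_exhaust_eq0 (h g : R -> R) (C : R) : measurable_fun setT h ->
  leb.-integrable setT (EFin \o g) -> (forall s, 0 < s -> `|h s| <= g s) ->
  (forall n, `|Rintegral leb `[n.+2%:R^-1, n.+2%:R] h| <= C / n.+2%:R) ->
  Rintegral leb `]0, +oo[ h = 0.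
Proof.
move=> mh ig hg hC.
have cL : Rintegral leb `[n.+2%:R^-1, n.+2%:R] h @[n --> \oo] --> Rintegral leb `]0, +oo[ h.
  rewrite Rintegral_mkcond.
  under eq_fun do rewrite Rintegral_mkcond.
  apply: (@Rintegral_cvg _ _ _ leb _ _ (fun s => `|g s|)).
  - by move=> n; apply/measurable_restrict => //; exact: measurable_funTS.
  - by apply/measurable_restrict => //; exact: measurable_funTS.
  - move=> s; apply: cvg_near_cst; have [s0|s0] := ltP 0 s; last first.
      near=> n; rewrite !patchE !ifF//; apply/negP; rewrite inE/= in_itv/= ?andbT.
        by rewrite ltNge s0.
      by move=> /andP[+ _]; rewrite leNgt (le_lt_trans s0)// invr_gt0.
    have ns : \forall n \near \oo, s <= n%:R by exact: nbhs_infty_ger.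
    have nsV : \forall n \near \oo, s^-1 <= n%:R by exact: nbhs_infty_ger.
    near=> n; rewrite !patchE !ifT//; rewrite inE/= in_itv/= ?s0//.
    have n2 : n%:R <= n.+2%:R :> R by rewrite ler_nat -addn2 leq_addr.
    apply/andP; split; last by apply: le_trans n2; near: n.
    rewrite -[leRHS]invrK lef_pV2 ?posrE ?invr_gt0//.
    by apply: le_trans n2; near: n.
  - exact: integrable_norm ig.
  - move=> n s; rewrite patchE; case: ifPn => [|_]; last by rewrite normr0.
    rewrite inE/= in_itv/= => /andP[ns _].
    apply: le_trans (hg _ _) (ler_norm _).
    by rewrite (lt_le_trans _ ns)// invr_gt0.
apply/eqP; rewrite -normr_le0; apply/ler_addgt0Pl => e e0; rewrite addr0.
apply: (cvgr_to_le (cvg_norm cL)).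
have : \forall n \near \oo, C / e <= n%:R by exact: nbhs_infty_ger.
apply: filterS => n Cn; apply: le_trans (hC n) _.
rewrite ler_pdivrMr// mulrC -ler_pdivrMr//; apply: le_trans Cn _.
by rewrite ler_nat -addn2 leq_addr.
Unshelve. all: by end_near. Qed.

Lemma expRN_le_inv_sqr (x : R) : 0 < x -> expR (- x) <= 4 / x ^+ 2.
Proof.
move=> x0; rewrite expRN -[leRHS]invrK lef_pV2 ?posrE ?expR_gt0 ?invr_gt0 ?divr_gt0 ?exprn_gt0//.
rewrite invf_div (_ : x = x / 2 + x / 2); last by field.
rewrite expRD -expr2 (_ : (x / 2 + x / 2) ^+ 2 / 4 = (x / 2) ^+ 2); last by field.
rewrite lerXn2r ?nnegrE ?expR_ge0 ?divr_ge0 ?ltW//.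
by apply: lt_le_trans (expR_ge1Dx _); rewrite ltrDr.
Qed.

End Gaussian.

Section ContourRotation.
Context {R : realType}.
Local Notation leb := (@lebesgue_measure R).

(** A straight path of square roots of directions. It also stretches the half-line, since its
    modulus exceeds 1 for [t != 0], which does no harm; in exchange its powers are polynomials in
    [t] and its derivative is the constant [i]. *)
Definition tilt (t : R) : R[i] := 1 +i* t.

Lemma cabs_tilt_le (t : R) : 0 <= t <= 1 -> cabs (tilt t) <= 2.
Proof.
move=> /andP[t0 t1]; rewrite (le_trans (cabs_le_ReIm _))//= normr1 ger0_norm//.
by rewrite (_ : 2 = 1 + 1)// lerD2l.
Qed.

Lemma is_cderive_tilt (t : R) : is_cderive t tilt 'i%C.
Proof. by split => /=; [exact: is_derive_cst|exact: is_derive_id]. Qed.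

Lemma cmeasurable_tilt d (T : measurableType d) (f : T -> R) : measurable_fun setT f ->
  cmeasurable (fun x => tilt (f x)).
Proof. by move=> mf; split => //=; exact: measurable_cst. Qed.

Lemma is_cderiveX (x : R) (f : R -> R[i]) df n : is_cderive x f df ->
  is_cderive x (fun t => f t ^+ n.+1) (n.+1%:R * f x ^+ n * df).
Proof.
move=> dfx; elim: n => [|n IH].
  by rewrite expr0 mul1r mul1r; under eq_fun do rewrite expr1.
under eq_fun do rewrite exprS.
apply: is_cderive_eq; first exact: (is_cderiveM dfx IH).
by rewrite -[n.+2]addn1 natrD exprS; ring.
Qed.

Variables A B D E : R[i].

(* [lam] is a square root of the rotation factor: the substitution of [lam ^ 2 * s]
   for [s] turns [sqrt s] into [lam * sqrt s] and [s ds] into [lam ^ 4 * s ds]. *)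
Definition rot_phase (lam : R[i]) (s : R) : R[i] :=
  A * lam ^+ 4 * s%:C ^+ 2 + B * lam ^+ 2 * s%:C + D * lam * (Num.sqrt s)%:C + E.

Definition rot_fun (lam : R[i]) (s : R) : R[i] :=
  lam ^+ 4 * s%:C * expC (rot_phase lam s).

(** With [zeta = lam ^ 2 * s] and [lam = tilt t], the holomorphic form [f(zeta) zeta dzeta] pulls
    back to [rot_fun ds + prim dt]: the [dt] component is [2 lam ^ 3 lam' s ^ 2 f], with [lam' = i].
    Closedness means that the [t]-derivative of [rot_fun] and the [s]-derivative of [prim] agree;
    [form] is their common value. *)
Let prim (t s : R) : R[i] :=
  2 * 'i%C * tilt t ^+ 3 * s%:C ^+ 2 * expC (rot_phase (tilt t) s).

Let form (t s : R) : R[i] := 'i%C * tilt t ^+ 3 *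
  (4 * s%:C + 4 * A * tilt t ^+ 4 * s%:C ^+ 3 + 2 * B * tilt t ^+ 2 * s%:C ^+ 2
   + D * tilt t * s%:C * (Num.sqrt s)%:C) * expC (rot_phase (tilt t) s).

Let is_cderive_rot_fun (t s : R) : is_cderive t (fun t => rot_fun (tilt t) s) (form t s).
Proof.
have dt := is_cderive_tilt t.
have c0 c := is_cderive_cst t c.
apply: is_cderive_eq.
  apply: is_cderiveM; first exact: (is_cderiveM (is_cderiveX 3 dt) (c0 s%:C)).
  apply: is_cderive_expC.
  apply: is_cderiveD (c0 E).
  apply: is_cderiveD (is_cderiveM (is_cderiveM (c0 D) dt) (c0 _)).
  apply: is_cderiveD (is_cderiveM (is_cderiveM (c0 B) (is_cderiveX 1 dt)) (c0 _)).
  exact: (is_cderiveM (is_cderiveM (c0 A) (is_cderiveX 3 dt)) (c0 _)).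
rewrite /form /rot_phase; by ring.
Qed.

Let is_cderive_prim (t s : R) : 0 < s -> is_cderive s (prim t) (form t s).
Proof.
move=> s0; have c0 c := is_cderive_cst s c.
have ds := is_cderive_real (is_derive_idfun s).
have dr := is_cderive_real (is_derive1_sqrt s0).
apply: is_cderive_eq.
  apply: is_cderiveM; first exact: (is_cderiveM (c0 _) (is_cderiveX 1 ds)).
  apply: is_cderive_expC.
  apply: is_cderiveD (c0 E).
  apply: is_cderiveD (is_cderiveM (c0 _) dr).
  apply: is_cderiveD (is_cderiveM (c0 _) ds).
  exact: (is_cderiveM (c0 _) (is_cderiveX 1 ds)).
(* The one discrepancy that [ring] cannot resolve: differentiating [sqrt s] produces
   [s ^ 2 / sqrt s], whereas [form] contains [s * sqrt s]. *)
have q : 2 * s%:C ^+ 2 * ((2 * Num.sqrt s)^-1)%:C - s%:C * (Num.sqrt s)%:C = 0 :> R[i].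
  rewrite -{1 3}(sqr_sqrtr (ltW s0)).
  have ss0 : Num.sqrt s != 0 by rewrite gt_eqF// sqrtr_gt0.
  by apply: complexRI => /=; field.
apply/eqP; rewrite -subr_eq0; apply/eqP.
rewrite /form /rot_phase.
transitivity ('i%C * tilt t ^+ 4 * D * expC (rot_phase (tilt t) s) *
  (2 * s%:C ^+ 2 * ((2 * Num.sqrt s)^-1)%:C - s%:C * (Num.sqrt s)%:C)); last by rewrite q mulr0.
rewrite (_ : 1%:C = 1)// /rot_phase; ring.
Qed.

Let cmeasurable_rot_phase d (T' : measurableType d) (f : T' -> R[i]) (g : T' -> R) :
  cmeasurable f -> measurable_fun setT g ->
  cmeasurable (fun z => rot_phase (f z) (g z)).
Proof.
move=> mf mg; have mc c := @cmeasurable_cst R _ T' c.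
have mg' := cmeasurable_real mg.
have ms := cmeasurable_real (measurable_sqrt_comp mg).
apply: cmeasurableD (mc E).
apply: cmeasurableD (cmeasurableM (cmeasurableM (mc D) mf) ms).
apply: cmeasurableD (cmeasurableM (cmeasurableM (mc B) (cmeasurableX 2 mf)) mg').
exact: cmeasurableM (cmeasurableM (mc A) (cmeasurableX 4 mf)) (cmeasurableX 2 mg').
Qed.

Lemma cmeasurable_rot_fun (lam : R[i]) : cmeasurable (rot_fun lam).
Proof.
apply: cmeasurableM.
  apply: cmeasurableM (cmeasurable_cst _) (cmeasurable_real _).
  exact: measurable_id.
by apply: cmeasurable_expC; apply: cmeasurable_rot_phase (cmeasurable_cst _) _.
Qed.

Let measurable_prim (b : R) : cmeasurable (fun t => prim t b).
Proof.
apply: cmeasurableM.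
  apply: cmeasurableM (cmeasurable_cst _).
  apply: cmeasurableM (cmeasurable_cst _) (cmeasurableX 3 (cmeasurable_tilt _)).
  exact: measurable_id.
apply: cmeasurable_expC; apply: cmeasurable_rot_phase => //.
by apply: cmeasurable_tilt; exact: measurable_id.
Qed.

Let cmeasurable_form : cmeasurable (fun z : R * R => form z.1 z.2).
Proof.
have ml := @cmeasurable_tilt _ (R * R)%type fst (@measurable_fst _ _ _ _).
have m2 : measurable_fun setT (snd : R * R -> R) by exact: measurable_snd.
have ms := cmeasurable_real m2.
have mr := cmeasurable_real (measurable_sqrt_comp m2).
have mc c := @cmeasurable_cst R _ (R * R)%type c.
apply: cmeasurableM; last by apply: cmeasurable_expC; exact: cmeasurable_rot_phase.
apply: cmeasurableM (cmeasurableM (mc _) (cmeasurableX 3 ml)) _.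
apply: cmeasurableD (cmeasurableM (cmeasurableM (cmeasurableM (mc _) ml) ms) mr).
apply: cmeasurableD (cmeasurableM (cmeasurableM (mc _) (cmeasurableX 2 ml)) (cmeasurableX 2 ms)).
apply: cmeasurableD (cmeasurableM (mc _) ms) _.
exact: cmeasurableM (cmeasurableM (mc _) (cmeasurableX 4 ml)) (cmeasurableX 3 ms).
Qed.

Let cderivable_form1 (t s : R) : cderivable t (form^~ s).
Proof.
have ml : cderivable t tilt by exists 'i%C; exact: is_cderive_tilt.
have mc c := cderivable_cst t c.
apply: cderivableM; last first.
  apply: cderivable_expC; apply: cderivableD (mc E).
  apply: cderivableD (cderivableM (cderivableM (mc D) ml) (mc _)).
  apply: cderivableD (cderivableM (cderivableM (mc B) (cderivableX 2 ml)) (mc _)).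
  exact: cderivableM (cderivableM (mc A) (cderivableX 4 ml)) (mc _).
apply: cderivableM (cderivableM (mc _) (cderivableX 3 ml)) _.
apply: cderivableD (cderivableM (cderivableM (cderivableM (mc _) ml) (mc _)) (mc _)).
apply: cderivableD (cderivableM (cderivableM (mc _) (cderivableX 2 ml)) (mc _)).
apply: cderivableD (mc _) _.
exact: cderivableM (cderivableM (mc _) (cderivableX 4 ml)) (mc _).
Qed.

Let cderivable_form2 (t s : R) : 0 < s -> cderivable s (form t).
Proof.
move=> s0; have ms := cderivable_real (is_derive_idfun s).
have mr := cderivable_real (is_derive1_sqrt s0).
have mc c := cderivable_cst s c.
apply: cderivableM; last first.
  apply: cderivable_expC; apply: cderivableD (mc E).
  apply: cderivableD (cderivableM (mc _) mr).
  apply: cderivableD (cderivableM (mc _) ms).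
  exact: cderivableM (mc _) (cderivableX 2 ms).
apply: cderivableM (mc _) _.
apply: cderivableD (cderivableM (cderivableM (mc _) ms) mr).
apply: cderivableD (cderivableM (mc _) (cderivableX 2 ms)).
apply: cderivableD (cderivableM (mc _) ms) _.
exact: cderivableM (mc _) (cderivableX 3 ms).
Qed.

Let form_bounded (a b : R) : 0 < a -> cbounded [set z : R * R | 0 <= z.1 <= 1 /\ a <= z.2 <= b]
  (fun z => form z.1 z.2).
Proof.
move=> a0; set S := [set _ | _].
have ml : cbounded S (fun z => tilt z.1).
  by exists 2 => z -[z1 _]; exact: cabs_tilt_le.
have ms : cbounded S (fun z => z.2%:C).
  apply: (@cbounded_real _ _ _ _ b) => z -[_ /andP[az zb]].
  by rewrite ger0_norm// (le_trans (ltW a0)).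
have mr : cbounded S (fun z => (Num.sqrt z.2)%:C).
  apply: (@cbounded_real _ _ _ _ (Num.sqrt b)) => z -[_ /andP[az zb]].
  by rewrite ger0_norm// ler_sqrt// (le_trans (ltW a0))// (le_trans az).
have mc c := @cbounded_cst R _ S c.
apply: cboundedM; last first.
  apply: cbounded_expC; apply: cboundedD (mc E).
  apply: cboundedD (cboundedM (cboundedM (mc D) ml) mr).
  apply: cboundedD (cboundedM (cboundedM (mc B) (cboundedX 2 ml)) ms).
  exact: cboundedM (cboundedM (mc A) (cboundedX 4 ml)) (cboundedX 2 ms).
apply: cboundedM (cboundedM (mc _) (cboundedX 3 ml)) _.
apply: cboundedD (cboundedM (cboundedM (cboundedM (mc _) ml) ms) mr).
apply: cboundedD (cboundedM (cboundedM (mc _) (cboundedX 2 ml)) (cboundedX 2 ms)).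
apply: cboundedD (cboundedM (mc _) ms) _.
exact: cboundedM (cboundedM (mc _) (cboundedX 4 ml)) (cboundedX 3 ms).
Qed.

Variables (delta T : R).
Hypothesis delta0 : 0 < delta.
Hypothesis T01 : 0 < T <= 1.
Hypothesis A_le : forall t : R, 0 <= t <= T -> complex.Re (A * tilt t ^+ 4) <= - delta.

(** Since [|tilt t| <= 2] and [sqrt s <= 1 + s], the lower-order terms of the phase are at most
    [|E| + 2 |D| + (4 |B| + 2 |D|) s]. Completing the square absorbs the linear term into half of
    [delta * s ^ 2], and the last summand is what remains. *)
Let K := cabs E + 2 * cabs D + (4 * cabs B + 2 * cabs D) ^+ 2 / (2 * delta).

Let t01 (t : R) : 0 <= t <= T -> 0 <= t <= 1.
Proof. by move: T01 => /andP[_ T1] /andP[-> tT]; rewrite (le_trans tT). Qed.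

Let Re_rot_phase_le (t s : R) : 0 <= t <= T -> 0 < s ->
  complex.Re (rot_phase (tilt t) s) <= K - delta / 2 * s ^+ 2.
Proof.
move=> t0T s0; have l2 := cabs_tilt_le (t01 t0T).
rewrite /rot_phase !ReD.
have h1 : complex.Re (A * tilt t ^+ 4 * s%:C ^+ 2) <= - delta * s ^+ 2.
  rewrite -rmorphXn ReM /= mulr0 subr0 ler_wpM2r ?sqr_ge0//; exact: A_le.
have h2 : complex.Re (B * tilt t ^+ 2 * s%:C) <= 4 * cabs B * s.
  apply: le_trans (ler_norm _) _; apply: le_trans (normr_Re_le _) _.
  rewrite cabsM (cabsM B) cabsX cabs_real gtr0_norm// ler_pM2r// mulrC.
  rewrite ler_wpM2r ?cabs_ge0//.
  have := cabs_ge0 (tilt t); nra.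
have h3 : complex.Re (D * tilt t * (Num.sqrt s)%:C) <= 2 * cabs D * (1 + s).
  apply: le_trans (ler_norm _) _; apply: le_trans (normr_Re_le _) _.
  rewrite !cabsM cabs_real ger0_norm//; apply: ler_pM => //.
  - by rewrite mulr_ge0 ?cabs_ge0.
  - by rewrite mulrC ler_wpM2r ?cabs_ge0.
  have ss := sqrtr_ge0 s; have := sqr_sqrtr (ltW s0).
  by have := sqr_ge0 (Num.sqrt s - 1); rewrite sqrrB expr1n mulr1; lra.
have h4 : complex.Re E <= cabs E by apply: le_trans (ler_norm _) (normr_Re_le _).
have h5 : (4 * cabs B + 2 * cabs D) * s <=
    delta / 2 * s ^+ 2 + (4 * cabs B + 2 * cabs D) ^+ 2 / (2 * delta).
  set c := 4 * _ + _; rewrite -subr_ge0.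
  rewrite (_ : _ - _ = (delta * s - c) ^+ 2 / (2 * delta)).
    by rewrite divr_ge0 ?sqr_ge0// mulr_ge0// ltW.
  by field; rewrite gt_eqF.
rewrite /K; lra.
Qed.

Let cabs_rot_fun_le (t s : R) : 0 <= t <= T -> 0 < s ->
  cabs (rot_fun (tilt t) s) <= 16 * expR K * (s * expR (- (delta / 2) * s ^+ 2)).
Proof.
move=> t0T s0; have l2 := cabs_tilt_le (t01 t0T).
rewrite /rot_fun cabsM (cabsM (tilt t ^+ 4)) cabsX cabs_real gtr0_norm// cabs_expC.
rewrite -mulrA [leRHS](_ : _ =
  16 * (s * (expR K * expR (- (delta / 2) * s ^+ 2)))); last by ring.
apply: ler_pM.
- by rewrite exprn_ge0// cabs_ge0.
- by rewrite mulr_ge0 ?expR_ge0// ltW.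
- by rewrite (_ : 16 = 2 ^+ 4); [rewrite lerXn2r ?nnegrE ?cabs_ge0|ring].
rewrite ler_pM2l// -expRD ler_expR mulNr; exact: Re_rot_phase_le.
Qed.

Let cabs_prim_le (t s : R) : 0 <= t <= T -> 0 < s ->
  cabs (prim t s) <= 16 * expR K * (s ^+ 2 * expR (- (delta / 2) * s ^+ 2)).
Proof.
move=> t0T s0; have l2 := cabs_tilt_le (t01 t0T).
rewrite /prim cabsM (cabsM _ (s%:C ^+ 2)) (cabsM _ (tilt t ^+ 3)) (cabsM 2) !cabsX.
rewrite cabs_real gtr0_norm// cabs_expC cabs_i.
rewrite (_ : 2 = 2%:R%:C :> R[i]); last by rewrite rmorph_nat.
rewrite cabs_real ger0_norm// mulr1.
rewrite [leLHS](_ : _ = 2 * (cabs (tilt t) ^+ 3 * (s ^+ 2 *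
  expR (complex.Re (rot_phase (tilt t) s))))); last by ring.
rewrite [leRHS](_ : _ =
  2 * (2 ^+ 3 * (s ^+ 2 * (expR K * expR (- (delta / 2) * s ^+ 2))))); last by ring.
rewrite ler_pM2l//; apply: ler_pM.
- by rewrite exprn_ge0// cabs_ge0.
- by rewrite mulr_ge0 ?expR_ge0// sqr_ge0.
- by rewrite lerXn2r ?nnegrE ?cabs_ge0.
rewrite ler_wpM2l ?sqr_ge0// -expRD ler_expR mulNr; exact: Re_rot_phase_le.
Qed.

(** In the last factor, 1 is for the inner end, where [s ^ 2 <= s]. The term [16 / delta ^ 2] is for
    the outer end, where [exp (- x) <= 4 / x ^ 2] with [x = delta / 2 * s ^ 2] leaves
    [16 / (delta ^ 2 s ^ 2)]. *)
Let C0 := 16 * expR K * (1 + 16 / delta ^+ 2).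

Let prim_lo (t : R) n : 0 <= t <= T -> cabs (prim t n.+2%:R^-1) <= C0 / n.+2%:R.
Proof.
move=> t0T; apply: le_trans (cabs_prim_le t0T _) _; first by rewrite invr_gt0.
rewrite /C0 -[leRHS]mulrA ler_pM2l ?mulr_gt0 ?expR_gt0//.
set a : R := n.+2%:R^-1.
have a0 : 0 < a by rewrite invr_gt0.
have a1 : a <= 1 by rewrite invf_le1// ler1n.
apply: (@le_trans _ _ (a ^+ 2)).
  rewrite ler_piMr ?sqr_ge0// -expR0 ler_expR mulNr oppr_le0.
  by rewrite mulr_ge0 ?sqr_ge0// divr_ge0// ltW.
apply: (@le_trans _ _ a); first by rewrite expr2 ler_piMl// ltW.
by rewrite ler_peMl ?(ltW a0)// lerDl divr_ge0 ?sqr_ge0.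
Qed.

Let prim_hi (t : R) n : 0 <= t <= T -> cabs (prim t n.+2%:R) <= C0 / n.+2%:R.
Proof.
move=> t0T; apply: le_trans (cabs_prim_le t0T _) _ => //.
rewrite /C0 -[leRHS]mulrA ler_pM2l ?mulr_gt0 ?expR_gt0//.
set a : R := n.+2%:R.
have a0 : 0 < a by [].
have a1 : 1 <= a by rewrite ler1n.
have x0 : 0 < delta / 2 * a ^+ 2 by rewrite mulr_gt0 ?exprn_gt0// divr_gt0.
apply: (@le_trans _ _ (16 / delta ^+ 2 / a ^+ 2)).
  rewrite mulNr; apply: le_trans (ler_wpM2l (sqr_ge0 _) (expRN_le_inv_sqr x0)) _.
  rewrite le_eqVlt; apply/orP; left; apply/eqP; field.
  by rewrite !gt_eqF.
apply: (@le_trans _ _ (16 / delta ^+ 2 / a)).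
  rewrite ler_wpM2l ?divr_ge0 ?sqr_ge0// lef_pV2 ?posrE ?exprn_gt0//.
  by rewrite expr2 ler_peMl// ltW.
by rewrite ler_wpM2r ?invr_ge0 ?(ltW a0)// lerDr.
Qed.

Let bound_int (v : R -> R -> R) n : (forall b, measurable_fun setT (v^~ b)) ->
  (forall t b, `|v t b| <= cabs (prim t b)) ->
  `|Rintegral leb `[0, T] (fun t => v t n.+2%:R - v t n.+2%:R^-1)| <= 2 * C0 / n.+2%:R.
Proof.
move: T01 => /andP[T0 T1] mv vle.
have mh : measurable_fun `[0, T] (fun t => v t n.+2%:R - v t n.+2%:R^-1).
  by apply: measurable_funTS; apply: measurable_funB.
have hle t : `[0, T]%classic t -> `|v t n.+2%:R - v t n.+2%:R^-1| <= 2 * C0 / n.+2%:R.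
  rewrite /= in_itv/= => t0T; apply: le_trans (ler_normB _ _) _.
  rewrite -mulrA mulr_natl mulr2n lerD// (le_trans (vle _ _))//.
    exact: prim_hi.
  exact: prim_lo.
have C00 : 0 <= 2 * C0 / n.+2%:R.
  by apply: le_trans (hle 0 _) => //=; rewrite in_itv/= lexx ltW.
have ih : leb.-integrable `[0, T] (EFin \o (fun t => v t n.+2%:R - v t n.+2%:R^-1)).
  apply: measurable_bounded_integrable => //.
    by rewrite /= lebesgue_measure_itv/= lte_fin T0 -EFinB ltry.
  exists (2 * C0 / n.+2%:R); split; first exact: num_real.
  by move=> x Cx t t0T /=; rewrite (le_trans (hle t t0T))// ltW.
apply: le_trans (le_normr_Rintegral _ ih) _ => //.
apply: le_trans (@le_Rintegral _ _ _ leb `[0, T] (fun t => `|v t n.+2%:R - v t n.+2%:R^-1|)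
  (fun=> 2 * C0 / n.+2%:R) _ _ _ hle) _ => //.
- exact: integrable_norm ih.
- apply: measurable_bounded_integrable => //.
    by rewrite /= lebesgue_measure_itv/= lte_fin T0 -EFinB ltry.
  exact: bounded_cst.
rewrite Rintegral_cst//= lebesgue_measure_itv/= lte_fin T0 /= subr0.
by rewrite ler_piMr.
Qed.

Let rot_cst : R := 16 * expR K.

Let integrable_rot_bound :
  leb.-integrable setT (fun s => (rot_cst * (`|s| * expR (- (delta / 2) * s ^+ 2)))%:E).
Proof.
under eq_fun do rewrite EFinM.
by apply: integrableZl => //; apply: integrable_norm_gaussian; rewrite divr_gt0.
Qed.

Lemma cintegrable_rot_fun (t : R) : 0 <= t <= T ->
  leb.-integrable `]0, +oo[ (fun s => (complex.Re (rot_fun (tilt t) s))%:E) /\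
  leb.-integrable `]0, +oo[ (fun s => (complex.Im (rot_fun (tilt t) s))%:E).
Proof.
move=> t0T; have [m1 m2] := cmeasurable_rot_fun (tilt t).
split; apply: le_integrable (integrableS _ _ _ integrable_rot_bound) => //.
- by apply/measurable_EFinP; exact: measurable_funTS.
- move=> s Ds; have s0 : 0 < s by move: Ds; rewrite /= in_itv/= andbT.
  rewrite !abse_EFin lee_fin.
  rewrite (le_trans (normr_Re_le _))// (le_trans (cabs_rot_fun_le t0T s0))//.
  by rewrite (le_trans _ (ler_norm _))// (gtr0_norm s0).
- by apply/measurable_EFinP; exact: measurable_funTS.
- move=> s Ds; have s0 : 0 < s by move: Ds; rewrite /= in_itv/= andbT.
  rewrite !abse_EFin lee_fin.
  rewrite (le_trans (normr_Im_le _))// (le_trans (cabs_rot_fun_le t0T s0))//.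
  by rewrite (le_trans _ (ler_norm _))// (gtr0_norm s0).
Qed.

Let T0T : 0 <= T <= T.
Proof. by move: T01 => /andP[/ltW -> _] /=. Qed.

Let z0T : (0 : R) <= (0 : R) <= T.
Proof. by move: T01 => /andP[/ltW -> _]; rewrite lexx. Qed.

Let diff_le (P : R[i] -> R) (s : R) : (forall z, `|P z| <= cabs z) -> 0 < s ->
  `|P (rot_fun (tilt T) s) - P (rot_fun (tilt 0) s)| <=
  2 * (rot_cst * (`|s| * expR (- (delta / 2) * s ^+ 2))).
Proof.
move=> Ple s0; apply: le_trans (ler_normB _ _) _; rewrite mulr_natl mulr2n lerD//.
  by rewrite (le_trans (Ple _))// (le_trans (cabs_rot_fun_le T0T s0))// gtr0_norm.
by rewrite (le_trans (Ple _))// (le_trans (cabs_rot_fun_le z0T s0))// gtr0_norm.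
Qed.

Let ab n : n.+2%:R^-1 < n.+2%:R :> R.
Proof.
by rewrite (@lt_le_trans _ _ 1) ?ler1n// invf_lt1// ltr1n.
Qed.

Let ge_inv n (s : R) : n.+2%:R^-1 <= s <= n.+2%:R -> 0 < s.
Proof. by move=> /andP[+ _]; apply: lt_le_trans; rewrite invr_gt0. Qed.

Let Re_diff n : `|Rintegral leb `[n.+2%:R^-1, n.+2%:R]
   (fun s => complex.Re (rot_fun (tilt T) s) - complex.Re (rot_fun (tilt 0) s))|
   <= 2 * C0 / n.+2%:R.
Proof.
have [M fM] := @form_bounded n.+2%:R^-1 n.+2%:R (ltac:(by rewrite invr_gt0)).
move: T01 => /andP[T0 _].
(* By Green's theorem the difference of the two truncated ray integrals is the contribution of the
   two arcs that close the contour; both are of order [1 / n.+2]. *)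
rewrite [X in `|X|](_ : _ = Rintegral leb `[0, T]
    (fun t => complex.Re (prim t n.+2%:R) - complex.Re (prim t n.+2%:R^-1))).
  apply: (bound_int (v := fun t b => complex.Re (prim t b))) => [b|t b].
    by case: (measurable_prim b).
  exact: normr_Re_le.
apply: (@rectangle_integral _ (fun t s => complex.Re (rot_fun (tilt t) s))
  (fun t s => complex.Re (prim t s)) (fun t s => complex.Re (form t s)) T _ _ M T0 (ab n)).
- by move=> t s _ _; case: (is_cderive_rot_fun t s).
- by move=> t s _ /ge_inv s0; case: (is_cderive_prim t s0).
- by move=> t s _ _; have [d /is_cderive_continuous[]] := cderivable_form1 t s.
- by move=> t s _ /ge_inv s0; have [d /is_cderive_continuous[]] := cderivable_form2 t s0.
- by case: cmeasurable_form.
- move=> t s t0T sab; apply: le_trans (normr_Re_le _) _.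
  by apply: (fM (t, s)); split => //=; exact: t01.
Qed.

Let Im_diff n : `|Rintegral leb `[n.+2%:R^-1, n.+2%:R]
   (fun s => complex.Im (rot_fun (tilt T) s) - complex.Im (rot_fun (tilt 0) s))|
   <= 2 * C0 / n.+2%:R.
Proof.
have [M fM] := @form_bounded n.+2%:R^-1 n.+2%:R (ltac:(by rewrite invr_gt0)).
move: T01 => /andP[T0 _].
rewrite [X in `|X|](_ : _ = Rintegral leb `[0, T]
    (fun t => complex.Im (prim t n.+2%:R) - complex.Im (prim t n.+2%:R^-1))).
  apply: (bound_int (v := fun t b => complex.Im (prim t b))) => [b|t b].
    by case: (measurable_prim b).
  exact: normr_Im_le.
apply: (@rectangle_integral _ (fun t s => complex.Im (rot_fun (tilt t) s))
  (fun t s => complex.Im (prim t s)) (fun t s => complex.Im (form t s)) T _ _ M T0 (ab n)).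
- by move=> t s _ _; case: (is_cderive_rot_fun t s).
- by move=> t s _ /ge_inv s0; case: (is_cderive_prim t s0).
- by move=> t s _ _; have [d /is_cderive_continuous[]] := cderivable_form1 t s.
- by move=> t s _ /ge_inv s0; have [d /is_cderive_continuous[]] := cderivable_form2 t s0.
- by case: cmeasurable_form.
- move=> t s t0T sab; apply: le_trans (normr_Im_le _) _.
  by apply: (fM (t, s)); split => //=; exact: t01.
Qed.

(* Cauchy's theorem in the sector between the rays of direction [1] and [1 + i T],
   the integrand being holomorphic in [sqrt s]. *)
Lemma contour_rotation :
  cint leb `]0, +oo[ (rot_fun (tilt T)) = cint leb `]0, +oo[ (rot_fun (tilt 0)).
Proof.
have [iT1 iT2] := cintegrable_rot_fun T0T.
have [i01 i02] := cintegrable_rot_fun z0T.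
have [mT1 mT2] := cmeasurable_rot_fun (tilt T).
have [m01 m02] := cmeasurable_rot_fun (tilt 0).
have i2 : leb.-integrable setT
    (EFin \o (fun s => 2 * (rot_cst * (`|s| * expR (- (delta / 2) * s ^+ 2))))).
  rewrite /comp; under eq_fun do rewrite EFinM.
  exact: integrableZl.
congr Complex; apply/eqP; rewrite -subr_eq0 -RintegralB//; apply/eqP.
  apply: Rintegral_exhaust_eq0 i2 _ Re_diff; first exact: measurable_funB.
  by move=> s; apply: diff_le; exact: normr_Re_le.
apply: Rintegral_exhaust_eq0 i2 _ Im_diff; first exact: measurable_funB.
by move=> s; apply: diff_le; exact: normr_Im_le.
Qed.

End ContourRotation.

(** * The kernel in ray coordinates *)

Section RealMeasurability.
Context {R : realType} d {T : measurableType d}.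

(** The inverse is not continuous at 0. It is therefore written by sign through exponential and
    logarithm, the convention [0^-1 = 0] supplying the remaining value. *)
Lemma measurable_funV (f : T -> R) : measurable_fun setT f ->
  measurable_fun setT (fun t => (f t)^-1).
Proof.
move=> mf.
have e (x : R) : x^-1 = if 0 < x then expR (- ln x) else
    if x < 0 then - expR (- ln (- x)) else 0.
  have [x0|x0|<-] := ltgtP 0 x; last by rewrite invr0.
    by rewrite expRN lnK.
  by rewrite expRN lnK ?posrE ?oppr_gt0// invrN opprK.
under eq_fun do rewrite e.
have ml (g : T -> R) : measurable_fun setT g -> measurable_fun setT (fun t => expR (- ln (g t))).
  move=> mg; apply: measurable_expR_comp; apply: measurableT_comp => //.
  exact: measurableT_comp.
apply: measurable_fun_ifT; [exact: measurable_fun_ltr|exact: ml|].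
apply: measurable_fun_ifT => //; first exact: measurable_fun_ltr.
by apply: measurableT_comp => //; apply: ml; exact: measurableT_comp.
Qed.

Lemma measurable_atan_comp (f : T -> R) : measurable_fun setT f ->
  measurable_fun setT (fun t => atan (f t)).
Proof.
move=> mf; apply: (measurableT_comp (f := atan)) => //.
by apply: continuous_measurable_fun => x; exact: continuous_atan.
Qed.

Lemma measurable_angle (f g : T -> R) : measurable_fun setT f -> measurable_fun setT g ->
  measurable_fun setT (fun t => angle (f t, g t)).
Proof.
move=> mf mg; rewrite /angle /=.
have ma : measurable_fun setT (fun t => atan (g t / f t)).
  by apply: measurable_atan_comp; apply: measurable_funM => //; exact: measurable_funV.
apply: measurable_fun_ifT => //; first exact: measurable_fun_ltr.
apply: measurable_fun_ifT => //; first exact: measurable_fun_ltr.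
exact: measurable_funD.
Qed.

Lemma measurable_norm2 (f g : T -> R) : measurable_fun setT f -> measurable_fun setT g ->
  measurable_fun setT (fun t => norm2 (f t, g t)).
Proof.
by move=> mf mg; apply: measurable_sqrt_comp; apply: measurable_funD; exact: measurable_funX.
Qed.

End RealMeasurability.

Section LambdaIntegrand.
Context {R : realType}.
Local Notation leb := (@lebesgue_measure R).

Definition Lambda_integrand (w : R[i]) (s : R) : R[i] :=
  (\1_(`[0, +oo[%classic : set R) s)%:C * expC (- (s ^+ 2)%:C - 2%:R * w * s%:C).

Lemma cmeasurable_Lambda_integrand d (T : measurableType d) (f : T -> R[i]) (g : T -> R) :
  cmeasurable f -> measurable_fun setT g ->
  cmeasurable (fun t => Lambda_integrand (f t) (g t)).
Proof.
move=> mf mg; apply: cmeasurableM.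
  by apply: cmeasurable_real; apply: measurableT_comp => //; exact: measurable_indic.
apply: cmeasurable_expC; apply: cmeasurableD; apply: cmeasurableN.
  by apply: cmeasurable_real; exact: measurable_funX.
by apply: cmeasurableM (cmeasurable_real mg); apply: cmeasurableM mf; exact: cmeasurable_cst.
Qed.

(** The inequality [(s + 2 Re w) ^ 2 >= 0] lets half of the Gaussian pay for the linear term. The
    price [exp (2 |w| ^ 2)] is affordable because [w] will be of the order of [sqrt |y|]. *)
Lemma cabs_Lambda_integrand_le (w : R[i]) (s : R) :
  cabs (Lambda_integrand w s) <= expR (2 * cabs w ^+ 2) * expR (- (1/2) * s ^+ 2).
Proof.
rewrite cabsM cabs_real cabs_expC -expRD.
have h : complex.Re (- (s ^+ 2)%:C - 2%:R * w * s%:C) <= 2 * cabs w ^+ 2 - (1/2) * s ^+ 2.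
  have e : complex.Re (- (s ^+ 2)%:C - 2%:R * w * s%:C) = - s ^+ 2 - 2 * complex.Re w * s.
    case: w => a b; rewrite (_ : 2%:R = 2%:R%:C :> R[i]) ?rmorph_nat//.
    by rewrite ReD !ReN !ReM ImM /=; ring.
  have : complex.Re w ^+ 2 <= cabs w ^+ 2 by rewrite cabs_sqr lerDl sqr_ge0.
  have := sqr_ge0 (s + 2 * complex.Re w); rewrite e sqrrD; lra.
apply: (@le_trans _ _ (1 * expR (complex.Re (- (s ^+ 2)%:C - 2%:R * w * s%:C)))).
  rewrite ler_wpM2r ?expR_ge0// indicE.
  by case: (_ \in _); rewrite ?normr0 ?normr1.
by rewrite mul1r ler_expR mulNr.
Qed.

Lemma cintegrable_Lambda_integrand (w : R[i]) : cintegrable leb (Lambda_integrand w).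
Proof.
apply: (@dominated_cintegrable R _ _ leb (Lambda_integrand w)
  (fun s => expR (2 * cabs w ^+ 2) * expR (- (1/2) * s ^+ 2))).
- by apply: cmeasurable_Lambda_integrand; [exact: cmeasurable_cst|exact: measurable_id].
- rewrite /comp; under eq_fun do rewrite EFinM.
  by apply: integrableZl => //; exact: integrable_gaussian.
- exact: cabs_Lambda_integrand_le.
Qed.

Lemma LambdaE (w : R[i]) :
  Lambda w = (2 / Num.sqrt pi)%:C * cint leb setT (Lambda_integrand w).
Proof. by rewrite /Lambda cint_mkcond. Qed.

Lemma cmeasurable_Lambda d (T : measurableType d) (f : T -> R[i]) :
  cmeasurable f -> cmeasurable (fun t => Lambda (f t)).
Proof.
move=> mf; under eq_fun do rewrite LambdaE.
apply: cmeasurableM; first exact: cmeasurable_cst.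
apply: (@cmeasurable_cint R _ _ T _ leb (fun z => Lambda_integrand (f z.1) z.2)).
apply: cmeasurable_Lambda_integrand; last exact: measurable_snd.
exact: (cmeasurable_comp measurable_fst mf).
Qed.

End LambdaIntegrand.

Section Kernel.
Context {R : realType}.
Local Notation leb := (@lebesgue_measure R).
Implicit Types (t eps : R) (x : R * R) (lam : R[i]) (z : R * R).

Definition ray_norm z : R := Num.sqrt (1 + z.2 ^+ 2) * `|z.1|.

Definition cos_part x z : R :=
  Num.sqrt (norm2 x * ray_norm z) * cos ((angle x - angle (z.1, z.1 * z.2)%R) / 2).

Definition sin_part x z : R :=
  - (Num.sqrt (norm2 x * ray_norm z) * sin ((angle x + angle (z.1, z.1 * z.2)%R) / 2)).

(** The exponents of the regulariser and of the Fresnel factor, the latter rewritten with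
    [- 1 / i = i]. The rotation multiplies [|y|] by [lam ^ 2] and leaves [|x|] alone. *)
Definition kernel_phase eps t x lam z : R[i] :=
  - (eps * ray_norm z ^+ 2)%:C * lam ^+ 4 +
  'i%C * ((norm2 x)%:C + lam ^+ 2 * (ray_norm z)%:C) ^+ 2 * ((4 * t)^-1)%:C.

Definition kernel_cst t : R[i] := (8%:R * 'i * pi%:C * t%:C)^-1 * (2 / Num.sqrt pi)%:C.

(* The integrand of [Psi_eps], in ray coordinates and before the integration of
   [Lambda] in [s], on the rotated rays [y = lam ^ 2 * (u, u m)]. *)
Definition kernel (b : bc) t x lam eps (w : (R * R) * R) : R[i] :=
  kernel_cst t * (`|w.1.1|%:C * lam ^+ 4 * expC (kernel_phase eps t x lam w.1)) *
  (Lambda_integrand (lam * ((cos_part x w.1)%:C / sqrt_it t)) w.2 +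
   bc_sign R b * Lambda_integrand (lam * ((sin_part x w.1)%:C / sqrt_it t)) w.2).

Definition ray_point lam z : R[i] * R[i] :=
  (lam ^+ 2 * (z.1)%:C, lam ^+ 2 * (z.1 * z.2)%:C).

Lemma ray_normE z : norm2 (z.1, z.1 * z.2) = ray_norm z.
Proof.
rewrite /norm2 /ray_norm /= -sqrtr_sqr -sqrtrM ?addr_ge0 ?sqr_ge0//.
by congr Num.sqrt; ring.
Qed.

Lemma ray_norm_ge0 z : 0 <= ray_norm z.
Proof. by rewrite mulr_ge0. Qed.

Lemma norm2_ge0 x : 0 <= norm2 x.
Proof. exact: sqrtr_ge0. Qed.

Lemma measurable_ray_norm : measurable_fun setT ray_norm.
Proof.
apply: measurable_funM; last exact: measurableT_comp.
apply: measurable_sqrt_comp; apply: measurable_funD => //.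
by apply: measurable_funX; exact: measurable_snd.
Qed.

Lemma measurable_angle_ray : measurable_fun setT (fun z => angle (z.1, z.1 * z.2)).
Proof.
apply: measurable_angle; first exact: measurable_fst.
by apply: measurable_funM; [exact: measurable_fst|exact: measurable_snd].
Qed.

Lemma measurable_cos_part x : measurable_fun setT (cos_part x).
Proof.
apply: measurable_funM.
  apply: measurable_sqrt_comp; apply: measurable_funM => //; exact: measurable_ray_norm.
apply: measurable_cos; apply: measurable_funM => //.
by apply: measurable_funB => //; exact: measurable_angle_ray.
Qed.

Lemma measurable_sin_part x : measurable_fun setT (sin_part x).
Proof.
apply: measurableT_comp => //; apply: measurable_funM.
  apply: measurable_sqrt_comp; apply: measurable_funM => //; exact: measurable_ray_norm.
apply: measurable_sin; apply: measurable_funM => //.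
by apply: measurable_funD => //; exact: measurable_angle_ray.
Qed.

Lemma cmeasurable_kernel_phase eps t x lam : cmeasurable (kernel_phase eps t x lam).
Proof.
have mc c := @cmeasurable_cst R _ (R * R)%type c.
have mr := cmeasurable_real measurable_ray_norm.
apply: cmeasurableD; first apply: cmeasurableM (mc _).
  apply: cmeasurableN; apply: cmeasurable_real; apply: measurable_funM => //.
  by apply: measurable_funX; exact: measurable_ray_norm.
apply: cmeasurableM (cmeasurableM (mc _) _) (mc _).
exact: cmeasurableX (cmeasurableD (mc _) (cmeasurableM (mc _) mr)).
Qed.

Lemma cmeasurable_kernel b t x lam eps : cmeasurable (kernel b t x lam eps).
Proof.
have mc c := @cmeasurable_cst R _ ((R * R) * R)%type c.
have m1 : measurable_fun setT (fun w : (R * R) * R => w.1) by exact: measurable_fst.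
have m2 : measurable_fun setT (fun w : (R * R) * R => w.2) by exact: measurable_snd.
have mco := cmeasurable_comp m1 (cmeasurable_real (measurable_cos_part x)).
have msi := cmeasurable_comp m1 (cmeasurable_real (measurable_sin_part x)).
apply: cmeasurableM.
  apply: cmeasurableM (mc _) _; apply: cmeasurableM.
    apply: cmeasurableM (mc _); apply: cmeasurable_real.
    by apply: measurableT_comp => //; exact: measurableT_comp.
  apply: cmeasurable_expC.
  exact: (cmeasurable_comp m1 (cmeasurable_kernel_phase eps t x lam)).
apply: cmeasurableD.
  by apply: cmeasurable_Lambda_integrand => //;
    exact: cmeasurableM (mc _) (cmeasurableM mco (mc _)).
apply: cmeasurableM (mc _) _.
by apply: cmeasurable_Lambda_integrand => //; exact: cmeasurableM (mc _) (cmeasurableM msi (mc _)).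
Qed.

Lemma cmeasurable_ray_point lam :
  cmeasurable (fun z => (ray_point lam z).1) /\ cmeasurable (fun z => (ray_point lam z).2).
Proof.
have mc c := @cmeasurable_cst R _ (R * R)%type c.
split; apply: cmeasurableM (mc _) _; apply: cmeasurable_real => //.
by apply: measurable_funM; [exact: measurable_fst|exact: measurable_snd].
Qed.

End Kernel.

(** * Gaussian bounds for the rotated kernel *)

Section Domination.
Context {R : realType}.
Local Notation leb := (@lebesgue_measure R).
Implicit Types (t eps : R) (x : R * R) (lam : R[i]) (z : R * R).

Lemma Re_tilt4 (tau : R) : complex.Re (tilt tau ^+ 4) = (1 - tau ^+ 2) ^+ 2 - 4 * tau ^+ 2.
Proof. by rewrite /tilt /=; ring. Qed.

Lemma Im_tilt4 (tau : R) : complex.Im (tilt tau ^+ 4) = 4 * tau * (1 - tau ^+ 2).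
Proof. by rewrite /tilt /=; ring. Qed.

Lemma Im_tilt2 (tau : R) : complex.Im (tilt tau ^+ 2) = 2 * tau.
Proof. by rewrite /tilt /=; ring. Qed.

Lemma cabs_tilt2_le (tau : R) : 0 <= tau <= 1 -> cabs (tilt tau) ^+ 2 <= 4.
Proof.
move=> t01; rewrite (_ : 4 = 2 ^+ 2); last by ring.
by rewrite lerXn2r ?nnegrE ?cabs_ge0// cabs_tilt_le.
Qed.

Lemma cabs_sqrt_it t : 0 < t -> cabs (sqrt_it t) ^+ 2 = t.
Proof.
move=> t0; by rewrite cabs_sqr /= sqr_sqrtr ?divr_ge0 ?ltW//; lra.
Qed.

(** The square [(|x| + lam ^ 2 |y|) ^ 2] also has a cross term. Its contribution to the real part is
    a nonpositive multiple of [Im (lam ^ 2) = 2 tau] and is dropped. *)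
Lemma Re_kernel_phase_le eps t x (tau : R) z : 0 < t -> 0 <= tau <= 4^-1 ->
  complex.Re (kernel_phase eps t x (tilt tau) z) <=
  - (eps * complex.Re (tilt tau ^+ 4) + complex.Im (tilt tau ^+ 4) / (4 * t)) * ray_norm z ^+ 2.
Proof.
move=> t0 /andP[tau0 tau1].
have -> : complex.Re (kernel_phase eps t x (tilt tau) z) =
  - (eps * complex.Re (tilt tau ^+ 4) + complex.Im (tilt tau ^+ 4) / (4 * t)) * ray_norm z ^+ 2
  - 2 * norm2 x * ray_norm z * complex.Im (tilt tau ^+ 2) / (4 * t).
  rewrite Re_tilt4 Im_tilt4 Im_tilt2 /kernel_phase ReD ReM Re_tilt4 Im_tilt4.
  by rewrite /tilt /=; field; rewrite gt_eqF.
rewrite lerBlDr lerDl Im_tilt2 divr_ge0 ?mulr_ge0 ?norm2_ge0 ?ray_norm_ge0//.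
exact: ltW.
Qed.

(** This is the exponent [2 |w| ^ 2] paid in [cabs_Lambda_integrand_le]. Squaring removes the square
    root, so it is linear in [|y|]; the constant 8 is [2 * 4], from [|tilt tau| ^ 2 <= 4], and
    [|sqrt_it t| ^ 2 = t]. *)
Lemma cabs_angular_le t x (tau : R) z (c : R) : 0 < t -> 0 <= tau <= 1 -> `|c| <= 1 ->
  2 * cabs (tilt tau * ((Num.sqrt (norm2 x * ray_norm z) * c)%:C / sqrt_it t)) ^+ 2
  <= 8 * norm2 x / t * ray_norm z.
Proof.
move=> t0 tau01 c1.
rewrite cabsM exprMn cabsM exprMn cabsV cabs_real exprVn cabs_sqrt_it//.
have s2 : Num.sqrt (norm2 x * ray_norm z) ^+ 2 = norm2 x * ray_norm z.
  by rewrite sqr_sqrtr// mulr_ge0 ?norm2_ge0 ?ray_norm_ge0.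
rewrite real_normK ?num_real// exprMn s2.
have c2 : c ^+ 2 <= 1 by rewrite -(real_normK (num_real c)) expr_le1.
have p0 : 0 <= norm2 x * ray_norm z / t.
  by rewrite divr_ge0 ?mulr_ge0 ?norm2_ge0 ?ray_norm_ge0// ltW.
have := cabs_tilt2_le tau01; have := sqr_ge0 (cabs (tilt tau)).
rewrite (_ : norm2 x * ray_norm z * c ^+ 2 / t = norm2 x * ray_norm z / t * c ^+ 2); last by ring.
rewrite (_ : 8 * norm2 x / t * ray_norm z = 8 * (norm2 x * ray_norm z / t)); last by ring.
move: (norm2 x * ray_norm z / t) (cabs (tilt tau) ^+ 2) p0 => p q p0 q0 q4.
have pc : p * c ^+ 2 <= p by rewrite ler_piMr.
have pc0 : 0 <= p * c ^+ 2 by rewrite mulr_ge0 ?sqr_ge0.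
nra.
Qed.

Lemma cabs_bc_sign b : cabs (bc_sign R b) = 1.
Proof. by case: b; rewrite /= ?cabsN cabs1. Qed.

Lemma normr_cos_le1 (a : R) : `|cos a| <= 1.
Proof. by rewrite ler_norml cos_geN1 cos_le1. Qed.

Lemma normr_sin_le1 (a : R) : `|sin a| <= 1.
Proof. by rewrite ler_norml sin_geN1 sin_le1. Qed.

(** The constant is [32 = 16 * 2]: [16] bounds [|lam ^ 4|], and there are two Lambda terms with the
    same bound. *)
Lemma cabs_kernel_le b t x (tau eps delta : R) w : 0 < t -> 0 <= tau <= 4^-1 ->
  delta <= eps * complex.Re (tilt tau ^+ 4) + complex.Im (tilt tau ^+ 4) / (4 * t) ->
  cabs (kernel b t x (tilt tau) eps w) <= 32 * cabs (kernel_cst t) *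
    (`|w.1.1| * expR (- delta * ray_norm w.1 ^+ 2 + 8 * norm2 x / t * ray_norm w.1)) *
    expR (- (1/2) * w.2 ^+ 2).
Proof.
move=> t0 tau01 dle.
have tau1 : 0 <= tau <= 1.
  by move: tau01 => /andP[-> h] /=; rewrite (le_trans h)// invf_le1// ler1n.
set L1 := Lambda_integrand (tilt tau * ((cos_part x w.1)%:C / sqrt_it t)) w.2.
set L2 := Lambda_integrand (tilt tau * ((sin_part x w.1)%:C / sqrt_it t)) w.2.
set e2 := expR (8 * norm2 x / t * ray_norm w.1) * expR (- (1/2) * w.2 ^+ 2).
have hL1 : cabs L1 <= e2.
  apply: le_trans (cabs_Lambda_integrand_le _ _) _; rewrite ler_pM2r ?expR_gt0//.
  by rewrite ler_expR; apply: cabs_angular_le => //; exact: normr_cos_le1.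
have hL2 : cabs L2 <= e2.
  apply: le_trans (cabs_Lambda_integrand_le _ _) _; rewrite ler_pM2r ?expR_gt0//.
  rewrite ler_expR /sin_part -mulrN; apply: cabs_angular_le => //.
  by rewrite normrN; exact: normr_sin_le1.
have hL : cabs (L1 + bc_sign R b * L2) <= 2 * e2.
  apply: le_trans (cabsD _ _) _; rewrite cabsM cabs_bc_sign mul1r.
  by rewrite mulr_natl mulr2n lerD.
have hE : cabs (expC (kernel_phase eps t x (tilt tau) w.1)) <= expR (- delta * ray_norm w.1 ^+ 2).
  rewrite cabs_expC ler_expR; apply: le_trans (Re_kernel_phase_le _ _ _ t0 tau01) _.
  by rewrite ler_wpM2r ?sqr_ge0// lerN2.
have h4 : cabs (tilt tau ^+ 4) <= 16.
  rewrite cabsX (_ : 16 = 2 ^+ 4); last by ring.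
  by rewrite lerXn2r ?nnegrE ?cabs_ge0// cabs_tilt_le.
have -> : kernel b t x (tilt tau) eps w = kernel_cst t * (`|w.1.1|%:C *
  (tilt tau ^+ 4 * expC (kernel_phase eps t x (tilt tau) w.1) * (L1 + bc_sign R b * L2))).
  by rewrite /kernel -/L1 -/L2 !mulrA.
rewrite cabsM (cabsM `|_|%:C) cabs_real normr_id (cabsM (_ * expC _)) (cabsM (tilt tau ^+ 4)).
have -> : 32 * cabs (kernel_cst t) *
    (`|w.1.1| * expR (- delta * ray_norm w.1 ^+ 2 + 8 * norm2 x / t * ray_norm w.1)) *
    expR (- (1/2) * w.2 ^+ 2) = cabs (kernel_cst t) * (`|w.1.1| *
  (16 * expR (- delta * ray_norm w.1 ^+ 2) * (2 * e2))).
  by rewrite expRD /e2; ring.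
rewrite ler_wpM2l ?cabs_ge0// ler_wpM2l//.
by rewrite ler_pM ?mulr_ge0 ?cabs_ge0 ?ler_pM ?cabs_ge0.
Qed.

(** Only half of the decay rate is kept; the other half is spent on the linear exponents, as in
    [linear_exponent_le]. Neither [x] nor the tilt occurs, so a single majorant serves for all of
    them. *)
Definition dominator (delta : R) (w : (R * R) * R) : R :=
  (`|w.1.1| * expR (- (delta / 2) * ray_norm w.1 ^+ 2)) * expR (- (1/2) * w.2 ^+ 2).

(** This is the Gaussian of the plane pulled back to ray coordinates, [|z.1|] being the Jacobian.
    Integrability in the slope comes from returning to the plane. *)
Lemma integrable_ray_gaussian (c : R) : 0 < c ->
  (@leb2 R).-integrable setT (fun z => (`|z.1| * expR (- c * ray_norm z ^+ 2))%:E).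
Proof.
move=> c0.
have mg : measurable_fun setT (fun y : R * R => expR (- c * y.1 ^+ 2) * expR (- c * y.2 ^+ 2)).
  by apply: measurable_funM; apply: measurableT_comp (measurable_gaussian c) _.
have := @integrable_prod R _ _ _ _ leb leb (fun u => expR (- c * u ^+ 2))
  (fun u => expR (- c * u ^+ 2)) (fun=> expR_ge0 _) (fun=> expR_ge0 _)
  (integrable_gaussian c0) (integrable_gaussian c0).
move=> /(integrable_ray mg); apply: eq_integrable => //= z _.
congr (_%:E); rewrite mulrC -expRD -ray_normE /norm2 /= sqr_sqrtr ?addr_ge0 ?sqr_ge0//.
by congr (_ * expR _); ring.
Qed.

Lemma integrable_dominator (delta : R) : 0 < delta ->
  (@leb2 R \x leb)%E.-integrable setT (EFin \o dominator delta).
Proof.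
move=> d0; have := @integrable_prod R _ _ _ _ (@leb2 R) leb
  (fun z => `|z.1| * expR (- (delta / 2) * ray_norm z ^+ 2)) (fun s => expR (- (1/2) * s ^+ 2)).
apply.
- by move=> z; rewrite mulr_ge0 ?expR_ge0.
- by move=> s; exact: expR_ge0.
- by apply: integrable_ray_gaussian; rewrite divr_gt0.
- exact: integrable_gaussian.
Qed.

Lemma linear_exponent_le (delta kappa rho : R) : 0 < delta ->
  expR (- delta * rho ^+ 2 + kappa * rho) <=
  expR (kappa ^+ 2 / (2 * delta)) * expR (- (delta / 2) * rho ^+ 2).
Proof.
move=> d0; rewrite -expRD ler_expR -subr_ge0.
rewrite (_ : _ - _ = (delta * rho - kappa) ^+ 2 / (2 * delta)).
  by rewrite divr_ge0 ?sqr_ge0// mulr_ge0// ltW.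
by field; rewrite gt_eqF.
Qed.

Lemma normC2_ray_point (tau : R) z : 0 <= tau <= 1 ->
  normC2 (ray_point (tilt tau) z) <= 4 * ray_norm z.
Proof.
move=> t01.
have e (a : R) : cabs (tilt tau ^+ 2 * a%:C) ^+ 2 = (cabs (tilt tau) ^+ 2) ^+ 2 * a ^+ 2.
  by rewrite cabsM (cabsX (tilt tau) 2) cabs_real exprMn real_normK ?num_real.
rewrite [normC2 _](_ : _ = Num.sqrt ((cabs (tilt tau) ^+ 2) ^+ 2 * (z.1 ^+ 2 + (z.1 * z.2) ^+ 2))).
  rewrite sqrtrM ?sqr_ge0// sqrtr_sqr ger0_norm ?sqr_ge0// -/(norm2 (z.1, z.1 * z.2)).
  by rewrite ray_normE ler_wpM2r ?ray_norm_ge0// cabs_tilt2_le.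
by rewrite /normC2 mulrDr -!e.
Qed.

(** The common source of integrability, of dominated convergence and of the final estimate. The
    growth [B] of [F] becomes [4 B], as [|lam ^ 2| <= 4], and joins the linear exponent of the
    Lambda terms. Since [M] enters linearly, a small [F] gives a small integral. *)
Lemma cabs_kernel_mul_le b t x (tau eps delta M B : R) (F : R[i] * R[i] -> R[i]) w :
  0 < t -> 0 <= tau <= 4^-1 -> 0 < delta ->
  delta <= eps * complex.Re (tilt tau ^+ 4) + complex.Im (tilt tau ^+ 4) / (4 * t) ->
  0 <= M -> 0 <= B ->
  cabs (F (ray_point (tilt tau) w.1)) <= M * expR (B * normC2 (ray_point (tilt tau) w.1)) ->
  cabs (kernel b t x (tilt tau) eps w * F (ray_point (tilt tau) w.1)) <=
  M * (32 * cabs (kernel_cst t) * expR ((8 * norm2 x / t + 4 * B) ^+ 2 / (2 * delta))) *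
  dominator delta w.
Proof.
move=> t0 tau01 d0 dle M0 B0 FM; rewrite cabsM.
have tau1 : 0 <= tau <= 1.
  by move: tau01 => /andP[-> h] /=; rewrite (le_trans h)// invf_le1// ler1n.
have hF : cabs (F (ray_point (tilt tau) w.1)) <= M * expR (4 * B * ray_norm w.1).
  apply: le_trans FM _; rewrite ler_wpM2l// ler_expR.
  rewrite (_ : 4 * B * ray_norm w.1 = B * (4 * ray_norm w.1)); last by ring.
  by rewrite ler_wpM2l// normC2_ray_point.
apply: le_trans (ler_pM (cabs_ge0 _) (cabs_ge0 _) (cabs_kernel_le b x w t0 tau01 dle) hF) _.
have := linear_exponent_le (8 * norm2 x / t + 4 * B) (ray_norm w.1) d0.
rewrite mulrDl addrA expRD => h.
rewrite /dominator; set g := expR (- (1 / 2) * _).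
rewrite [leLHS](_ : _ = (M * (32 * cabs (kernel_cst t)) * `|w.1.1| * g) *
  (expR (- delta * ray_norm w.1 ^+ 2 + 8 * norm2 x / t * ray_norm w.1) *
   expR (4 * B * ray_norm w.1))); last by ring.
rewrite [leRHS](_ : _ = (M * (32 * cabs (kernel_cst t)) * `|w.1.1| * g) *
  (expR ((8 * norm2 x / t + 4 * B) ^+ 2 / (2 * delta)) *
   expR (- (delta / 2) * ray_norm w.1 ^+ 2))); last by ring.
by rewrite ler_wpM2l// !mulr_ge0 ?expR_ge0 ?cabs_ge0.
Qed.

(** At the full tilt [Im (lam ^ 4) = 15 / 16], and division by [4 t] gives the rate [15 / (64 t)].
    As [Re (lam ^ 4) = 161 / 256] is positive, the regulariser only helps, so the bound is uniform
    in [eps >= 0]. *)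
Lemma tilt_quarter_rate t eps : 0 < t -> 0 <= eps ->
  15 / 64 / t <= eps * complex.Re (tilt 4^-1 ^+ 4) + complex.Im (tilt 4^-1 ^+ 4) / (4 * t).
Proof.
move=> t0 e0; rewrite Re_tilt4 Im_tilt4.
rewrite (_ : (1 - 4^-1 ^+ 2) ^+ 2 - 4 * 4^-1 ^+ 2 = 161 / 256); last by field.
rewrite (_ : 4 * 4^-1 * (1 - 4^-1 ^+ 2) / (4 * t) = 15 / 64 / t); last by field; rewrite gt_eqF.
by rewrite lerDr mulr_ge0.
Qed.

(** During the rotation the Fresnel contribution may vanish, at [tau = 0], and is only known to be
    nonnegative. The rate comes from the regulariser, with [Re (lam ^ 4) >= 1 / 2]. *)
Lemma tilt_rate t eps (tau : R) : 0 < t -> 0 < eps -> 0 <= tau <= 4^-1 ->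
  eps / 2 <= eps * complex.Re (tilt tau ^+ 4) + complex.Im (tilt tau ^+ 4) / (4 * t).
Proof.
move=> t0 e0 /andP[tau0 tau1]; rewrite Re_tilt4 Im_tilt4.
have h2 : tau ^+ 2 <= 16^-1.
  by rewrite (_ : 16^-1 = 4^-1 ^+ 2); [rewrite lerXn2r ?nnegrE|field].
have q : 0 <= 4 * tau * (1 - tau ^+ 2) / (4 * t).
  by rewrite divr_ge0 ?mulr_ge0 ?(ltW t0)//; lra.
have : 1 / 2 <= (1 - tau ^+ 2) ^+ 2 - 4 * tau ^+ 2.
  by have := sqr_ge0 tau; move: (tau ^+ 2) h2 => y; nra.
move: (_ - 4 * _) => y hy; nra.
Qed.

End Domination.

Section ExpGrowth.
Context {R : realType}.

(** Measurability on [C ^ 2] is expressed through compositions, in keeping with [cmeasurable], which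
    speaks of real and imaginary parts only. *)
Definition cmeasurable2 (F : R[i] * R[i] -> R[i]) :=
  forall d (T : measurableType d) (f g : T -> R[i]),
  cmeasurable f -> cmeasurable g -> cmeasurable (fun t => F (f t, g t)).

Definition exp_growth (F : R[i] * R[i] -> R[i]) (M B : R) :=
  forall z, cabs (F z) <= M * expR (B * normC2 z).

End ExpGrowth.

Section PsiKernel.
Context {R : realType}.
Local Notation leb := (@lebesgue_measure R).
Implicit Types (t eps : R) (x : R * R) (lam : R[i]) (z : R * R).

Lemma tilt0 : tilt (0 : R) = 1.
Proof. by []. Qed.

Lemma cmeasurable_Green b t x : cmeasurable (Green b t x).
Proof.
have mc c := @cmeasurable_cst R _ (R * R)%type c.
have mn : measurable_fun setT (fun y : R * R => norm2 y).
  by apply: (measurable_norm2 (f := fst) (g := snd)); [exact: measurable_fst|exact: measurable_snd].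
have ma : measurable_fun setT (fun y : R * R => angle y).
  by apply: (measurable_angle (f := fst) (g := snd)); [exact: measurable_fst|exact: measurable_snd].
have ms : measurable_fun setT (fun y : R * R => Num.sqrt (norm2 x * norm2 y)).
  by apply: measurable_sqrt_comp; exact: measurable_funM.
apply: cmeasurableM.
  apply: cmeasurableM (mc _); apply: cmeasurable_expC; apply: cmeasurableM (mc _).
  apply: cmeasurableN; apply: cmeasurable_real.
  by apply: measurable_funX; exact: measurable_funD.
apply: cmeasurableD; last apply: cmeasurableM (mc _) _.
  apply: cmeasurable_Lambda; apply: cmeasurableM (mc _); apply: cmeasurable_real.
  apply: measurable_funM => //; apply: measurable_cos; apply: measurable_funM => //.
  exact: measurable_funB.
apply: cmeasurable_Lambda; apply: cmeasurableM (mc _); apply: cmeasurableN.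
apply: cmeasurable_real; apply: measurable_funM => //; apply: measurable_sin.
by apply: measurable_funM => //; exact: measurable_funD.
Qed.

Lemma measurable_Omega : measurable (@Omega R).
Proof.
rewrite (_ : @Omega R = ~` (fst @^-1` [set 0] `&` snd @^-1` `]-oo, 0])).
  apply: measurableC; apply: measurableI.
    by rewrite -[X in measurable X]setTI; apply: measurable_fst => //; exact: measurable_set1.
  by rewrite -[X in measurable X]setTI; apply: measurable_snd => //; exact: measurable_itv.
by apply/seteqP; split => y /=; rewrite /Omega /= in_itv.
Qed.

Lemma oscillating_phaseE (a t : R) : 0 < t ->
  - (a ^+ 2)%:C / (4%:R * 'i * t%:C) = 'i%C * a%:C ^+ 2 * ((4 * t)^-1)%:C :> R[i].
Proof.
move=> t0; rewrite imagE.
have i0 : 'i%C != 0 :> R[i] by rewrite eq_complex/= oner_eq0 andbF.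
have t4 : t%:C != 0 :> R[i] by rewrite eq_complex/= eqxx andbT gt_eqF.
have c4 : 4%:R * 'i%C * t%:C != 0 :> R[i] by rewrite !mulf_neq0// pnatr_eq0.
apply: (mulIf c4); rewrite divfK//.
rewrite (_ : (4 * t)^-1%:C = (4%:R * t%:C)^-1); last first.
  by rewrite fmorphV rmorphM rmorph_nat.
rewrite rmorphXn.
transitivity ('i%C ^+ 2 * a%:C ^+ 2 * ((4%:R * t%:C)^-1 * (4%:R * t%:C)) : R[i]); last by ring.
by rewrite mulVf ?mulf_neq0 ?pnatr_eq0// mulr1 sqr_i mulN1r.
Qed.

Lemma kernel_mul_integral b F t x lam eps z :
  cint leb setT (fun s => kernel b t x lam eps (z, s) * F (ray_point lam z)) =
  kernel_cst t * (`|z.1|%:C * lam ^+ 4 * expC (kernel_phase eps t x lam z)) *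
  (cint leb setT (Lambda_integrand (lam * ((cos_part x z)%:C / sqrt_it t))) +
   bc_sign R b * cint leb setT (Lambda_integrand (lam * ((sin_part x z)%:C / sqrt_it t)))) *
  F (ray_point lam z).
Proof.
have i1 := cintegrable_Lambda_integrand (lam * ((cos_part x z)%:C / sqrt_it t)).
have i2 := cintegrable_Lambda_integrand (lam * ((sin_part x z)%:C / sqrt_it t)).
have i2' := cintegrableZl (bc_sign R b) i2.
rewrite -(cintZl _ i2) -(cintD i1 i2') -(cintZl _ (cintegrableD i1 i2')).
rewrite mulrC -cintZl; last by apply: cintegrableZl; exact: cintegrableD.
by apply: eq_cint => s _; rewrite mulrC.
Qed.

Lemma cintegrable_kernel_mul b F t x (tau eps delta M B : R) :
  0 < t -> 0 <= tau <= 4^-1 -> 0 < delta ->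
  delta <= eps * complex.Re (tilt tau ^+ 4) + complex.Im (tilt tau ^+ 4) / (4 * t) ->
  0 <= M -> 0 <= B -> exp_growth F M B -> cmeasurable2 F ->
  cintegrable (@leb2 R \x leb)%E
    (fun w => kernel b t x (tilt tau) eps w * F (ray_point (tilt tau) w.1)).
Proof.
move=> t0 tau01 d0 dle M0 B0 FMB mF.
apply: (@dominated_cintegrable R _ _ (@leb2 R \x leb)%E _ (fun w =>
  M * (32 * cabs (kernel_cst t) * expR ((8 * norm2 x / t + 4 * B) ^+ 2 / (2 * delta))) *
  dominator delta w)).
- apply: cmeasurableM; first exact: cmeasurable_kernel.
  have [m1 m2] := @cmeasurable_ray_point R (tilt tau).
  apply: (mF _ ((R * R) * R)%type (fun w => (ray_point (tilt tau) w.1).1)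
    (fun w => (ray_point (tilt tau) w.1).2)).
    exact: (cmeasurable_comp measurable_fst m1).
  exact: (cmeasurable_comp measurable_fst m2).
- rewrite /comp; under eq_fun do rewrite EFinM.
  by apply: integrableZl => //; exact: integrable_dominator.
- by move=> w; apply: cabs_kernel_mul_le.
Qed.

(** At tilt 0 nothing is rotated yet. The Gaussian supplied by [eps > 0] makes the integrand
    integrable jointly in the point and in [s], so the integral defining Lambda can be pulled
    outside. *)
Lemma Psi_eps_kernel b F t x (eps M B : R) : 0 < t -> 0 < eps ->
  0 <= M -> 0 <= B -> exp_growth F M B -> cmeasurable2 F ->
  Psi_eps b F t x eps =
  cint (@leb2 R \x leb)%E setT
    (fun w => kernel b t x (tilt 0) eps w * F (ray_point (tilt 0) w.1)).
Proof.
move=> t0 e0 M0 B0 FMB mF.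
have tau0 : 0 <= (0 : R) <= 4^-1 by apply/andP; split; rewrite ?invr_ge0.
have rate := tilt_rate t0 e0 tau0.
rewrite -(cint12 (cintegrable_kernel_mul b x t0 tau0 (divr_gt0 e0 (ltr0Sn _ 1)) rate M0 B0 FMB mF)).
rewrite /Psi_eps cint_mkcond.
set h := fun y : R * R => (\1_(@Omega R) y)%:C *
  ((expR (- eps * norm2 y ^+ 2))%:C * Green b t x y * F (y.1%:C, y.2%:C)).
have mh : cmeasurable h.
  apply: cmeasurableM.
    by apply: cmeasurable_real; apply: measurable_indic; exact: measurable_Omega.
  apply: cmeasurableM; last first.
    by apply: mF; apply: cmeasurable_real; [exact: measurable_fst|exact: measurable_snd].
  apply: cmeasurableM (cmeasurable_Green _ _ _); apply: cmeasurable_real.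
  apply: measurable_expR_comp; apply: measurable_funM => //; apply: measurable_funX.
  by apply: (measurable_norm2 (f := fst) (g := snd)); [exact: measurable_fst|exact: measurable_snd].
have -> : cint (@leb2 R) setT h =
    cint (@leb2 R) setT (fun z => h (z.1, z.1 * z.2) * `|z.1|%:C).
  have [m1 m2] := mh; apply: complexRI; rewrite /= /Rintegral.
    rewrite (integral_ray m1); congr fine; apply: eq_integral => z _.
    by rewrite (ReM (h _)) /= mulr0 subr0.
  rewrite (integral_ray m2); congr fine; apply: eq_integral => z _.
  by rewrite (ImM (h _)) /= mulr0 add0r.
apply: eq_cint => z _; rewrite kernel_mul_integral.
(* On the line containing the slit the Jacobian annihilates both sides; every other point lies in
   [Omega], where the indicator is 1. *)
have [u0|u0] := eqVneq z.1 0; first by rewrite u0 normr0 mulr0 !mul0r mulr0 !mul0r.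
rewrite /h indicE mem_set ?mul1r; last by rewrite /Omega /= => -[/eqP]; rewrite (negbTE u0).
rewrite {1}/Green !ray_normE !LambdaE /=.
rewrite tilt0 !expr1n !mulr1.
have -> : expC (kernel_phase eps t x 1 z) = (expR (- eps * ray_norm z ^+ 2))%:C *
    expC (- ((norm2 x + ray_norm z) ^+ 2)%:C / (4%:R * 'i * t%:C)).
  rewrite -expC_real -expCD; congr expC; rewrite oscillating_phaseE//.
  rewrite /kernel_phase !expr1n mulr1 mul1r; congr (_ + _).
    by rewrite -rmorphN mulNr.
  by rewrite rmorphD.
have -> : ray_point 1 z = (z.1%:C, (z.1 * z.2)%:C).
  by rewrite /ray_point expr1n !mul1r.
rewrite /kernel_cst /cos_part /sin_part [(- (_ * sin _))%:C]rmorphN.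
set e1 := expC _; set e2 := (expR _)%:C; set L1 := cint _ _ _; set L2 := cint _ _ _.
by set c1 := (8%:R * _ * _ * _)^-1; set c2 := (2 / Num.sqrt pi)%:C; ring.
Qed.

End PsiKernel.

(** * Rotation of the kernel *)

Section HalfLines.
Context {R : realType}.
Local Notation leb := (@lebesgue_measure R).

Lemma integral_oppr (g : R -> R) : measurable_fun setT g ->
  (\int[leb]_u (g u)%:E = \int[leb]_u (g (- u))%:E)%E.
Proof.
move=> mg; rewrite integralE [RHS]integralE; congr (_ - _)%E.
  rewrite ge0_integral_oppr//; last exact/measurable_funepos/measurable_EFinP.
  by apply: eq_integral => u _; rewrite !funeposE.
rewrite ge0_integral_oppr//; last exact/measurable_funeneg/measurable_EFinP.
by apply: eq_integral => u _; rewrite !funenegE.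
Qed.

Lemma Rintegral_half_lines (g : R -> R) : leb.-integrable setT (EFin \o g) ->
  Rintegral leb setT g =
  Rintegral leb `]0, +oo[ g + Rintegral leb `]0, +oo[ (fun u => g (- u)).
Proof.
move=> ig.
have mg : measurable_fun setT g by case/integrableP: ig => /measurable_EFinP.
have <- : `]-oo, 0[%classic `|` `[0, +oo[%classic = [set: R].
  by apply/seteqP; split => // u _; rewrite /= !in_itv/= andbT; case: ltP; [left|right].
rewrite Rintegral_setU//; last 2 first.
- by apply: integrableS ig => //; exact: measurableU.
- by apply/disj_setPS => u [/=]; rewrite !in_itv/= andbT ltNge => /negbTE ->.
rewrite addrC; congr (_ + _).
  by rewrite Rintegral_itv_obnd_cbnd//; apply: integrableS ig.
rewrite [LHS]Rintegral_mkcond [RHS]Rintegral_mkcond /Rintegral integral_oppr.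
  congr fine; apply: eq_integral => u _; rewrite !patchE.
  have -> : (- u \in `]-oo, 0[%classic) = (u \in `]0, +oo[%classic).
    by apply/idP/idP; rewrite !inE/= !in_itv/= andbT oppr_lt0.
  by [].
by apply/measurable_restrict => //; exact: measurable_funTS.
Qed.

Lemma cint_half_lines (f : R -> R[i]) : cintegrable leb f ->
  cint leb setT f = cint leb `]0, +oo[ f + cint leb `]0, +oo[ (fun u => f (- u)).
Proof. by move=> [f1 f2]; apply: complexRI; rewrite ?ReD ?ImD /= -Rintegral_half_lines. Qed.

Lemma cintegrable_indic (D : set R) (f : R -> R[i]) : measurable D ->
  leb.-integrable D (fun u => (complex.Re (f u))%:E) ->
  leb.-integrable D (fun u => (complex.Im (f u))%:E) ->
  cintegrable leb (fun u => (\1_D u)%:C * f u).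
Proof.
move=> mD i1 i2.
have {}i1 := (@integrable_mkcond _ _ _ leb D _ mD).1 i1.
have {}i2 := (@integrable_mkcond _ _ _ leb D _ mD).1 i2.
split.
  apply: eq_integrable i1 => // u _; rewrite patchE indicE ReM /= mul0r subr0.
  by case: ifPn => _; rewrite ?mul1r ?mul0r.
apply: eq_integrable i2 => // u _; rewrite patchE indicE ImM /= mul0r addr0.
by case: ifPn => _; rewrite ?mul1r ?mul0r.
Qed.

End HalfLines.

Section KernelRotation.
Context {R : realType}.
Local Notation leb := (@lebesgue_measure R).
Variables (b : bc) (t eps : R) (x k : R * R).
Hypotheses (t0 : 0 < t) (e0 : 0 < eps).

Section HalfRay.
Variables (m s sg th : R).
Hypothesis sg1 : sg ^+ 2 = 1.
Hypothesis angle_sg : forall u : R, 0 < u -> angle (sg * u, sg * u * m) = th.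

(** On the half-ray [|y| = n * u]. The exponent is sorted by powers of [sqrt u]: [A] holds the
    regulariser and the quadratic Fresnel term, [B] the Fresnel cross term and the plane wave, [D]
    the linear term of the Lambda integrand, with the cosine or minus the sine as its argument [c],
    and [E] what is constant in [u]. *)
Let n := Num.sqrt (1 + m ^+ 2).
Let r := norm2 x.
Let A : R[i] := - (eps * n ^+ 2)%:C + 'i%C * (n ^+ 2 * (4 * t)^-1)%:C.
Let B : R[i] := 'i%C * (2 * r * n * (4 * t)^-1)%:C + 'i%C * (sg * (k.1 + k.2 * m))%:C.
Let D (c : R) : R[i] := (- 2 * s * Num.sqrt (r * n) * c)%:C * (sqrt_it t)^-1.
Let E : R[i] := 'i%C * (r ^+ 2 * (4 * t)^-1)%:C - (s ^+ 2)%:C.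
Let c1 := cos ((angle x - th) / 2).
Let c2 := - sin ((angle x + th) / 2).
Let c0 : R[i] := kernel_cst t * (\1_(`[0, +oo[%classic : set R) s)%:C.

Let kernel_half_ray lam (u : R) : 0 < u ->
  kernel b t x lam eps ((sg * u, m), s) * pwave k (ray_point lam (sg * u, m)) =
  c0 * (rot_fun A B (D c1) E lam u + bc_sign R b * rot_fun A B (D c2) E lam u).
Proof.
move=> u0.
have nsg : `|sg| = 1 by apply/eqP; rewrite -sqrp_eq1// real_normK ?num_real// sg1.
have nu : `|sg * u| = u by rewrite normrM nsg mul1r gtr0_norm.
have rn : ray_norm (sg * u, m) = n * u by rewrite /ray_norm /= nu.
have sq : Num.sqrt (r * (n * u)) = Num.sqrt (r * n) * Num.sqrt u.
  by rewrite mulrA sqrtrM//; apply: mulr_ge0; exact: sqrtr_ge0.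
have key (c : R) : rot_fun A B (D c) E lam u = u%:C * lam ^+ 4 *
    expC (kernel_phase eps t x lam (sg * u, m)) *
    expC (- (s ^+ 2)%:C - 2%:R * (lam * ((Num.sqrt (r * (n * u)) * c)%:C / sqrt_it t)) * s%:C) *
    pwave k (ray_point lam (sg * u, m)).
  have -> : rot_fun A B (D c) E lam u = lam ^+ 4 * u%:C *
      (expC (kernel_phase eps t x lam (sg * u, m)) *
      expC (- (s ^+ 2)%:C - 2%:R * (lam * ((Num.sqrt (r * (n * u)) * c)%:C / sqrt_it t)) * s%:C) *
      pwave k (ray_point lam (sg * u, m))).
    rewrite /rot_fun /pwave -!expCD; congr (_ * expC _).
    rewrite /rot_phase /kernel_phase rn sq imagE /A /B /D /E /ray_point /=.
    by rewrite -/r; set q := (sqrt_it t)^-1; set tt := (4 * t)^-1; ring.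
  by move: (expC _) (expC _) (pwave _ _) => a1 a2 a3; ring.
rewrite !key /kernel /cos_part /sin_part /Lambda_integrand /= angle_sg// rn -/r nu -/c1.
rewrite (_ : - (Num.sqrt (r * (n * u)) * sin ((angle x + th) / 2)) =
  Num.sqrt (r * (n * u)) * c2); last by rewrite mulrN.
rewrite /c0.
set e1 := expC (kernel_phase _ _ _ _ _); set e2 := pwave _ _.
set e3 := expC _; set e4 := expC _.
by ring.
Qed.

Let rate (tau : R) : 0 <= tau <= 4^-1 ->
  complex.Re (A * tilt tau ^+ 4) <= - (n ^+ 2 * (eps / 2)).
Proof.
move=> tau01; have := tilt_rate t0 e0 tau01.
have -> : complex.Re (A * tilt tau ^+ 4) = - (n ^+ 2 * (eps * complex.Re (tilt tau ^+ 4)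
    + complex.Im (tilt tau ^+ 4) / (4 * t))).
  by rewrite /A ReM !ReD !ImD /= ; ring.
by move=> h; rewrite lerN2 ler_wpM2l ?sqr_ge0.
Qed.

Let n0 : 0 < n ^+ 2 * (eps / 2).
Proof.
by rewrite mulr_gt0 ?divr_gt0// exprn_gt0// sqrtr_gt0 ltr_pwDl ?sqr_ge0.
Qed.

Let T01 : 0 < (4^-1 : R) <= 1.
Proof. by apply/andP; split; rewrite ?invr_gt0// invf_le1// ler1n. Qed.

Lemma half_ray_rotation :
  cint leb `]0, +oo[ (fun u => kernel b t x (tilt 4^-1) eps ((sg * u, m), s) *
                               pwave k (ray_point (tilt 4^-1) (sg * u, m))) =
  cint leb `]0, +oo[ (fun u => kernel b t x (tilt 0) eps ((sg * u, m), s) *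
                               pwave k (ray_point (tilt 0) (sg * u, m))).
Proof.
have i0 c (tau : R) : 0 <= tau <= 4^-1 -> cintegrable leb
    (fun u => (\1_(`]0, +oo[%classic : set R) u)%:C * rot_fun A B (D c) E (tilt tau) u).
  move=> tau01; have [i1 i2] := cintegrable_rot_fun B (D c) E n0 T01 rate tau01.
  exact: cintegrable_indic.
have expand (tau : R) : 0 <= tau <= 4^-1 ->
    cint leb `]0, +oo[ (fun u => kernel b t x (tilt tau) eps ((sg * u, m), s) *
                               pwave k (ray_point (tilt tau) (sg * u, m))) =
    c0 * (cint leb `]0, +oo[ (rot_fun A B (D c1) E (tilt tau)) +
          bc_sign R b * cint leb `]0, +oo[ (rot_fun A B (D c2) E (tilt tau))).
  move=> tau01; have j1 := i0 c1 _ tau01; have j2 := i0 c2 _ tau01.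
  have j2' := cintegrableZl (bc_sign R b) j2.
  rewrite !(@cint_mkcond R _ _ leb (`]0, +oo[%classic : set R))
    -(cintZl _ j2) -cintD// -cintZl; last exact: cintegrableD.
  apply: eq_cint => u _; rewrite indicE.
  have [|_] := boolP (u \in _); last by rewrite !mul0r mulr0 addr0 mulr0.
  by rewrite inE/= in_itv/= andbT => u0; rewrite kernel_half_ray// !mul1r.
rewrite !expand; last 2 first.
- by apply/andP; split; rewrite ?invr_ge0.
- by apply/andP; split; rewrite ?invr_ge0.
by rewrite !(contour_rotation _ _ _ n0 T01 rate).
Qed.

End HalfRay.

(** Along the line of slope [m] the angle is [atan m] for [u > 0] and [pi + atan m] for [u < 0]. The
    two halves are therefore rotated separately, with [sg = 1] and [sg = -1]. *)
Lemma kernel_line_rotation (m s : R) :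
  (forall tau : R, 0 <= tau <= 4^-1 ->
    cintegrable leb (fun u => kernel b t x (tilt tau) eps ((u, m), s) *
                               pwave k (ray_point (tilt tau) (u, m)))) ->
  cint leb setT (fun u => kernel b t x (tilt 4^-1) eps ((u, m), s) *
                               pwave k (ray_point (tilt 4^-1) (u, m))) =
  cint leb setT (fun u => kernel b t x (tilt 0) eps ((u, m), s) *
                               pwave k (ray_point (tilt 0) (u, m))).
Proof.
move=> i; rewrite !cint_half_lines; last 2 first.
- by apply: i; apply/andP; split; rewrite ?invr_ge0.
- by apply: i; apply/andP; split; rewrite ?invr_ge0.
have mK (u : R) : u != 0 -> u * m / u = m by move=> u0; rewrite mulrAC divff// mul1r.
congr (_ + _).
  have := @half_ray_rotation m s 1 (atan m) (expr1n _ _) _.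
  rewrite /= (_ : (fun u => _) = fun u => kernel b t x (tilt 4^-1) eps ((u, m), s) *
    pwave k (ray_point (tilt 4^-1) (u, m))); last by apply/funext => u; rewrite mul1r.
  rewrite (_ : (fun u => kernel b t x (tilt 0) eps ((1 * u, m), s) * _) =
    fun u => kernel b t x (tilt 0) eps ((u, m), s) *
    pwave k (ray_point (tilt 0) (u, m))); last by apply/funext => u; rewrite mul1r.
  by apply => u u0; rewrite mul1r /angle /= u0 mK ?gt_eqF.
have := @half_ray_rotation m s (-1) (pi + atan m) _ _.
rewrite /= (_ : (fun u => _) = fun u => kernel b t x (tilt 4^-1) eps ((- u, m), s) *
  pwave k (ray_point (tilt 4^-1) (- u, m))); last by apply/funext => u; rewrite mulN1r.
rewrite (_ : (fun u => kernel b t x (tilt 0) eps ((-1 * u, m), s) * _) =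
  fun u => kernel b t x (tilt 0) eps ((- u, m), s) *
  pwave k (ray_point (tilt 0) (- u, m))); last by apply/funext => u; rewrite mulN1r.
apply; first by rewrite sqrrN expr1n.
move=> u u0; rewrite mulN1r /angle /= oppr_gt0 oppr_lt0 u0 ltNge ltW//= mK//.
by rewrite oppr_eq0 gt_eqF.
Qed.

End KernelRotation.

(** * Superpositions of plane waves *)

Section PlaneWaves.
Context {R : realType}.

Lemma cabs_le_normC2 (z : R[i] * R[i]) : cabs z.1 <= normC2 z /\ cabs z.2 <= normC2 z.
Proof.
by split; rewrite -[leLHS]ger0_norm ?cabs_ge0// -sqrtr_sqr ler_sqrt ?addr_ge0 ?sqr_ge0//;
  rewrite ?lerDl ?lerDr sqr_ge0.
Qed.

Lemma normr_le_norm2 (k : R * R) : `|k.1| <= norm2 k /\ `|k.2| <= norm2 k.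
Proof.
by split; rewrite -sqrtr_sqr ler_sqrt ?addr_ge0 ?sqr_ge0// ?lerDl ?lerDr sqr_ge0.
Qed.

Lemma cabs_pwave_le (k : R * R) (k0 : R) z : norm2 k <= k0 ->
  cabs (pwave k z) <= expR (2 * k0 * normC2 z).
Proof.
move=> kk0; rewrite cabs_expC ler_expR imagE.
apply: le_trans (ler_norm _) _; apply: le_trans (normr_ReM_le _ _) _.
rewrite cabs_i mul1r; apply: le_trans (cabsD _ _) _; rewrite !cabsM !cabs_real.
have [z1 z2] := cabs_le_normC2 z; have [k1 k2] := normr_le_norm2 k.
rewrite -mulrA mulr_natl mulr2n lerD// ler_pM ?cabs_ge0//.
  exact: le_trans k1 kk0.
exact: le_trans k2 kk0.
Qed.

Lemma exp_growth_pwave (k : R * R) : exp_growth (pwave k) 1 (2 * norm2 k).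
Proof. by move=> z; rewrite mul1r cabs_pwave_le. Qed.

Lemma cmeasurable_pwave d (T : measurableType d) (k : T -> R * R) (f g : T -> R[i]) :
  measurable_fun setT k -> cmeasurable f -> cmeasurable g ->
  cmeasurable (fun t => pwave (k t) (f t, g t)).
Proof.
move=> mk mf mg; apply: cmeasurable_expC; apply: cmeasurableM.
  exact: cmeasurable_cst.
have m1 : measurable_fun setT (fun t => (k t).1) by exact: measurableT_comp.
have m2 : measurable_fun setT (fun t => (k t).2) by exact: measurableT_comp.
by apply: cmeasurableD; apply: cmeasurableM => //; exact: cmeasurable_real.
Qed.

Lemma cmeasurable2_pwave (k : R * R) : cmeasurable2 (pwave k).
Proof. by move=> d T f g mf mg; apply: cmeasurable_pwave => //; exact: measurable_cst. Qed.

Lemma measurable_cball (k0 : R) : measurable (cball k0).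
Proof.
have mn : measurable_fun setT (fun y : R * R => norm2 y).
  by apply: (measurable_norm2 (f := fst) (g := snd)); [exact: measurable_fst|exact: measurable_snd].
rewrite (_ : cball k0 = setT `&` (fun y : R * R => norm2 y) @^-1` `]-oo, k0]).
  by apply: mn => //; exact: measurable_itv.
by rewrite setTI; apply/seteqP; split => y /=; rewrite in_itv.
Qed.

End PlaneWaves.

Section FubiniPlaneWaves.
Context {R : realType} d {T : measurableType d} (mu : {sigma_finite_measure set T -> \bar R}).
Variables (k0 : R) (V : T -> R[i]) (zeta : T -> R[i] * R[i]) (g : T -> R).
Hypothesis mV : cmeasurable V.
Hypothesis mzeta1 : cmeasurable (fun w => (zeta w).1).
Hypothesis mzeta2 : cmeasurable (fun w => (zeta w).2).
Hypothesis ig : mu.-integrable setT (EFin \o g).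
Hypothesis Vg : forall w, cabs (V w) * expR (2 * k0 * normC2 (zeta w)) <= g w.

Let zetaE w : zeta w = ((zeta w).1, (zeta w).2).
Proof. by case: (zeta w). Qed.

Let g_ge0 w : 0 <= g w.
Proof. by apply: le_trans (Vg w); rewrite mulr_ge0 ?cabs_ge0 ?expR_ge0. Qed.

Let mpw k : cmeasurable (fun w => pwave k (zeta w)).
Proof.
under eq_fun do rewrite zetaE.
by apply: cmeasurable_pwave => //; exact: measurable_cst.
Qed.

Section OneMeasure.
Variable nu : {finite_measure set (R * R)%type -> \bar R}.

Let ind (k : R * R) : R := \1_(cball k0) k.

Let integrable_ind : nu.-integrable setT (EFin \o ind).
Proof. by apply: integrable_indic => //; exact: measurable_cball. Qed.

Let mind : measurable_fun setT ind.
Proof. by apply: measurable_indic; exact: measurable_cball. Qed.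

Let cabs_ind_pwave k z : cabs ((ind k)%:C * pwave k z) <= expR (2 * k0 * normC2 z) * ind k.
Proof.
rewrite cabsM cabs_real /ind indicE; have [|_] := boolP (k \in _).
  by rewrite inE => kk0; rewrite normr1 mul1r mulr1 cabs_pwave_le.
by rewrite normr0 mul0r mulr0.
Qed.

Lemma cintegrable_ind_pwave z : cintegrable nu (fun k => (ind k)%:C * pwave k z).
Proof.
apply: (@dominated_cintegrable _ _ _ nu _ (fun k => expR (2 * k0 * normC2 z) * ind k)) => //.
  apply: cmeasurableM; first exact: cmeasurable_real.
  case: z => z1 z2; apply: cmeasurable_pwave; [exact: measurable_id|exact: cmeasurable_cst..].
rewrite /comp; under eq_fun do rewrite EFinM.
exact: integrableZl.
Qed.

Lemma cabs_cint_pwave_le z : cabs (cint nu (cball k0) (fun k => pwave k z)) <=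
  2 * Rintegral nu setT ind * expR (2 * k0 * normC2 z).
Proof.
rewrite cint_mkcond -mulrA [X in _ * X]mulrC -RintegralZl//.
apply: cabs_cint_le => //.
  apply: cmeasurableM; first exact: cmeasurable_real.
  case: z => z1 z2; apply: cmeasurable_pwave; [exact: measurable_id|exact: cmeasurable_cst..].
rewrite /comp; under eq_fun do rewrite EFinM.
exact: integrableZl.
Qed.

Lemma cmeasurable_cint_pwave :
  cmeasurable (fun w => cint nu (cball k0) (fun k => pwave k (zeta w))).
Proof.
under eq_fun do rewrite cint_mkcond.
apply: (@cmeasurable_cint R _ _ T _ nu (fun p => (ind p.2)%:C * pwave p.2 (zeta p.1))).
apply: cmeasurableM.
  by apply: cmeasurable_real; apply: measurableT_comp => //; exact: measurable_snd.
under eq_fun do rewrite zetaE.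
apply: cmeasurable_pwave; first exact: measurable_snd.
  exact: (cmeasurable_comp measurable_fst mzeta1).
exact: (cmeasurable_comp measurable_fst mzeta2).
Qed.

Lemma cintegrable_mul_cint_pwave :
  cintegrable mu (fun w => V w * cint nu (cball k0) (fun k => pwave k (zeta w))).
Proof.
apply: (@dominated_cintegrable _ _ _ mu _ (fun w => 2 * Rintegral nu setT ind * g w)).
- by apply: cmeasurableM => //; exact: cmeasurable_cint_pwave.
- by rewrite /comp; under eq_fun do rewrite EFinM; exact: integrableZl.
- move=> w; rewrite cabsM; apply: le_trans (ler_wpM2l (cabs_ge0 _) (cabs_cint_pwave_le _)) _.
  rewrite mulrCA ler_wpM2l// mulr_ge0//; apply: Rintegral_ge0 => k _.
  by rewrite /ind indicE.
Qed.

(** On the ball, plane waves have the common bound [exp (2 k0 |z|)]. The product of the indicator of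
    the ball with [g] is then an integrable majorant, [nu] being finite, and Fubini applies. *)
Lemma cint_mul_cint_pwave :
  cint mu setT (fun w => V w * cint nu (cball k0) (fun k => pwave k (zeta w))) =
  cint nu (cball k0) (fun k => cint mu setT (fun w => V w * pwave k (zeta w))).
Proof.
pose f (p : (R * R) * T) := (ind p.1)%:C * (V p.2 * pwave p.1 (zeta p.2)).
have mf : cmeasurable f.
  apply: cmeasurableM.
    by apply: cmeasurable_real; apply: measurableT_comp => //; exact: measurable_fst.
  apply: cmeasurableM; first exact: (cmeasurable_comp measurable_snd mV).
  under eq_fun do rewrite zetaE.
  apply: cmeasurable_pwave; first exact: measurable_fst.
    exact: (cmeasurable_comp measurable_snd mzeta1).
  exact: (cmeasurable_comp measurable_snd mzeta2).
have i_f : cintegrable (nu \x mu)%E f.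
  apply: (@dominated_cintegrable _ _ _ (nu \x mu)%E f (fun p => ind p.1 * g p.2)) => //.
    apply: (@integrable_prod R _ _ _ _ nu mu ind g _ g_ge0 integrable_ind ig).
    by move=> k; rewrite /ind indicE.
  move=> p; rewrite /f mulrCA cabsM.
  apply: le_trans (ler_wpM2l (cabs_ge0 _) (cabs_ind_pwave _ _)) _.
  by rewrite mulrA mulrC ler_wpM2l// /ind indicE.
rewrite [RHS]cint_mkcond.
transitivity (cint mu setT (fun w => cint nu setT (fun k => f (k, w)))).
  apply: eq_cint => w _; rewrite cint_mkcond -cintZl; last exact: cintegrable_ind_pwave.
  by apply: eq_cint => k _; rewrite /f/= mulrCA.
rewrite (cint21 i_f) -(cint12 i_f); apply: eq_cint => k _; rewrite /f/= -/(ind k).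
rewrite /ind indicE; have [|_] := boolP (k \in _).
  by rewrite inE => kk0; rewrite mul1r; apply: eq_cint => w _; rewrite mul1r.
rewrite mul0r; apply: complexRI; rewrite /= /Rintegral integral0_eq// => w _;
  by rewrite mul0r.
Qed.

End OneMeasure.

Lemma cint_mul_cmint_pwave (m : cmeasure R) :
  cint mu setT (fun w => V w * cmint m (cball k0) (fun k => pwave k (zeta w))) =
  cmint m (cball k0) (fun k => cint mu setT (fun w => V w * pwave k (zeta w))).
Proof.
rewrite /cmint -!cint_mul_cint_pwave.
have i1 := cintegrable_mul_cint_pwave (cm_rp m).
have i2 := cintegrable_mul_cint_pwave (cm_rn m).
have i3 := cintegrable_mul_cint_pwave (cm_ip m).
have i4 := cintegrable_mul_cint_pwave (cm_in m).
rewrite -(cintB i1 i2) -(cintB i3 i4) -cintZl; last exact: cintegrableD (cintegrableN _).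
rewrite -cintD.
- by apply: eq_cint => w _; ring.
- exact: cintegrableD (cintegrableN _).
- by apply: cintegrableZl; exact: cintegrableD (cintegrableN _).
Qed.

End FubiniPlaneWaves.

Section GrowthSuperposition.
Context {R : realType}.
Variables (k0 : R) (mu : nat -> cmeasure R) (n : nat).

Lemma cmeasurable2_Fmu : cmeasurable2 (Fmu k0 mu n).
Proof.
move=> d T f g mf mg.
have m nu := cmeasurable_cint_pwave k0 (zeta := fun t => (f t, g t)) mf mg nu.
apply: cmeasurableD; first by apply: cmeasurableD => //; exact: cmeasurableN.
apply: cmeasurableM; first exact: cmeasurable_cst.
by apply: cmeasurableD => //; exact: cmeasurableN.
Qed.

Lemma exp_growth_Fmu : exists2 M : R, 0 <= M & exp_growth (Fmu k0 mu n) M (2 * k0).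
Proof.
pose I (nu : {finite_measure set (R * R)%type -> \bar R}) :=
  2 * Rintegral nu setT (fun k => \1_(cball k0) k : R).
have I0 nu : 0 <= I nu.
  by rewrite mulr_ge0//; apply: Rintegral_ge0 => k _; rewrite /= indicE.
exists (I (cm_rp (mu n)) + I (cm_rn (mu n)) + (I (cm_ip (mu n)) + I (cm_in (mu n)))).
  by rewrite !addr_ge0.
move=> z; have h nu := @cabs_cint_pwave_le R k0 nu z.
rewrite /Fmu /cmint imagE; apply: le_trans (cabsD _ _) _; rewrite mulrDl lerD//.
  by apply: le_trans (cabsD _ _) _; rewrite cabsN mulrDl lerD// h.
rewrite cabsM cabs_i mul1r.
by apply: le_trans (cabsD _ _) _; rewrite cabsN mulrDl lerD// h.
Qed.

End GrowthSuperposition.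

(** * Rotated formula for the wave function and removal of the regulariser *)

Section RotatedRepresentation.
Context {R : realType}.
Local Notation leb := (@lebesgue_measure R).
Implicit Types (t eps : R) (x : R * R).

Let quarter : (0 : R) <= (4^-1 : R) <= 4^-1.
Proof. by rewrite invr_ge0 lexx andbT. Qed.

Let zero_quarter : (0 : R) <= (0 : R) <= 4^-1.
Proof. by apply/andP; split; rewrite ?invr_ge0. Qed.

Lemma kernel_rotation b t x eps (k : R * R) : 0 < t -> 0 < eps ->
  cint (@leb2 R \x leb)%E setT (fun w => kernel b t x (tilt 4^-1) eps w *
                                         pwave k (ray_point (tilt 4^-1) w.1)) =
  cint (@leb2 R \x leb)%E setT (fun w => kernel b t x (tilt 0) eps w *
                                         pwave k (ray_point (tilt 0) w.1)).
Proof.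
move=> t0 e0; have e20 : 0 < eps / 2 by rewrite divr_gt0.
have k0 : 0 <= 2 * norm2 k by rewrite mulr_ge0// norm2_ge0.
pose f tau w := kernel b t x (tilt tau) eps w * pwave k (ray_point (tilt tau) w.1).
pose C := 1 * (32 * cabs (kernel_cst t) *
  expR ((8 * norm2 x / t + 4 * (2 * norm2 k)) ^+ 2 / (2 * (eps / 2)))).
have fle (tau : R) w : 0 <= tau <= 4^-1 -> cabs (f tau w) <= C * dominator (eps / 2) w.
  move=> tau01; apply: cabs_kernel_mul_le => //; first exact: tilt_rate.
  exact: exp_growth_pwave.
have i_f (tau : R) : 0 <= tau <= 4^-1 -> cintegrable (@leb2 R \x leb)%E (f tau).
  move=> tau01; apply: (cintegrable_kernel_mul b x t0 tau01 e20 _ _ k0 (exp_growth_pwave k)) => //.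
    exact: tilt_rate.
  exact: cmeasurable2_pwave.
have m_f (tau : R) : cmeasurable (f tau).
  apply: cmeasurableM; first exact: cmeasurable_kernel.
  have [m1 m2] := @cmeasurable_ray_point R (tilt tau).
  apply: (@cmeasurable2_pwave R k _ ((R * R) * R)%type (fun w => (ray_point (tilt tau) w.1).1)
    (fun w => (ray_point (tilt tau) w.1).2)).
    exact: (cmeasurable_comp measurable_fst m1).
  exact: (cmeasurable_comp measurable_fst m2).
(* The explicit majorant gives integrability on every slice, here for each [s] and below for each
   slope and [s], whereas Fubini's theorem would give it only for almost every slice. *)
have i_fs (tau s : R) : 0 <= tau <= 4^-1 -> cintegrable (leb \x leb)%E (fun z => f tau (z, s)).
  move=> tau01; apply: (@dominated_cintegrable _ _ _ (leb \x leb)%E _ (fun z =>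
    C * expR (- (1/2) * s ^+ 2) * (`|z.1| * expR (- (eps / 2 / 2) * ray_norm z ^+ 2)))).
  - exact: (cmeasurable_comp (measurable_pair2 s) (m_f tau)).
  - rewrite /comp; under eq_fun do rewrite EFinM.
    by apply: integrableZl => //; apply: integrable_ray_gaussian; rewrite divr_gt0.
  - move=> z; apply: le_trans (fle tau (z, s) tau01) _.
    by rewrite /dominator /= -[leRHS]mulrA [expR _ * (_ * _)]mulrC.
have i_fms (tau m s : R) : 0 <= tau <= 4^-1 -> cintegrable leb (fun u => f tau ((u, m), s)).
  move=> tau01; apply: (@dominated_cintegrable _ _ _ leb _ (fun u =>
    C * expR (- (1/2) * s ^+ 2) * (`|u| * expR (- (eps / 2 / 2 * (1 + m ^+ 2)) * u ^+ 2)))).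
  - exact: (cmeasurable_comp (measurable_pair2 m)
      (cmeasurable_comp (measurable_pair2 s) (m_f tau))).
  - rewrite /comp; under eq_fun do rewrite EFinM.
    apply: integrableZl => //; apply: integrable_norm_gaussian.
    by rewrite mulr_gt0 ?divr_gt0// ltr_pwDl ?sqr_ge0.
  - move=> u; apply: le_trans (fle tau ((u, m), s) tau01) _.
    rewrite /dominator /= -[leRHS]mulrA [expR _ * (_ * _)]mulrC /ray_norm /= exprMn.
    by rewrite sqr_sqrtr ?addr_ge0 ?sqr_ge0// real_normK ?num_real//
      (_ : - (eps / 2 / 2) * ((1 + m ^+ 2) * u ^+ 2) = - (eps / 2 / 2 * (1 + m ^+ 2)) * u ^+ 2);
      last by ring.
(* The integrals are reordered so that [u] is innermost; with [s] and the slope frozen, both sides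
   agree line by line. *)
rewrite -[LHS](cint21 (i_f _ quarter)) -[RHS](cint21 (i_f _ zero_quarter)).
apply: eq_cint => s _.
have h (tau : R) : 0 <= tau <= 4^-1 -> cint (@leb2 R) setT (fun z => f tau (z, s)) =
    cint leb setT (fun m => cint leb setT (fun u => f tau ((u, m), s))).
  by move=> tau01; exact/esym/(cint21 (i_fs _ s tau01)).
apply: etrans (h _ quarter) _; apply: etrans (esym (h _ zero_quarter)).
apply: eq_cint => m _.
by apply: kernel_line_rotation => // tau tau01; exact: (i_fms tau m s).
Qed.

(** The parameter [eps] enters only through the exponential of an affine function, so the kernel is
    derivable in [eps] at 0, hence continuous there. *)
Lemma kernel_cvg b t x lam (c : R[i]) w :
  (complex.Re (kernel b t x lam eps w * c) @[eps --> 0^'+] -->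
   complex.Re (kernel b t x lam 0 w * c)) /\
  (complex.Im (kernel b t x lam eps w * c) @[eps --> 0^'+] -->
   complex.Im (kernel b t x lam 0 w * c)).
Proof.
suff [d /is_cderive_continuous[h1 h2]] :
    cderivable 0 (fun eps => kernel b t x lam eps w * c).
  by split; apply: cvg_at_right_filter; [exact: h1|exact: h2].
have mc e := @cderivable_cst R 0 e.
apply: cderivableM (mc _); apply: cderivableM (mc _); apply: cderivableM (mc _) _.
apply: cderivableM (mc _) _; apply: cderivable_expC; apply: cderivableD (mc _).
rewrite (_ : (fun _ => _) = fun eps => (- (ray_norm w.1 ^+ 2))%:C * lam ^+ 4 * eps%:C).
  by apply: cderivableM (mc _) _; exact: (cderivable_real (is_derive_idfun 0)).
by apply/funext => eps; rewrite -rmorphN -mulrN rmorphM; ring.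
Qed.

(** The [lim] in [Psi] is meaningful only once convergence is shown. Dominated convergence provides
    it along the rotated formula, whose majorant has the rate [15 / (64 t)] for all [eps >= 0]. *)
Lemma Psi_limit b F t x (M B : R) : 0 < t -> 0 <= M -> 0 <= B ->
  exp_growth F M B -> cmeasurable2 F ->
  (forall eps, 0 < eps -> Psi_eps b F t x eps =
    cint (@leb2 R \x leb)%E setT (fun w => kernel b t x (tilt 4^-1) eps w *
                                           F (ray_point (tilt 4^-1) w.1))) ->
  Psi b F t x = cint (@leb2 R \x leb)%E setT (fun w => kernel b t x (tilt 4^-1) 0 w *
                                                       F (ray_point (tilt 4^-1) w.1)).
Proof.
move=> t0 M0 B0 FMB mF Pe.
have mK (e : R) : cmeasurable (fun w => kernel b t x (tilt 4^-1) e w *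
                                           F (ray_point (tilt 4^-1) w.1)).
  apply: cmeasurableM; first exact: cmeasurable_kernel.
  have [m1 m2] := @cmeasurable_ray_point R (tilt 4^-1).
  apply: (mF _ ((R * R) * R)%type (fun w => (ray_point (tilt 4^-1) w.1).1)
    (fun w => (ray_point (tilt 4^-1) w.1).2)).
    exact: (cmeasurable_comp measurable_fst m1).
  exact: (cmeasurable_comp measurable_fst m2).
have d0 : 0 < 15 / 64 / t by rewrite !divr_gt0.
have [] := @cint_at_right_cvg R _ _ (@leb2 R \x leb)%E
  (fun e w => kernel b t x (tilt 4^-1) e w * F (ray_point (tilt 4^-1) w.1))
  (fun w => kernel b t x (tilt 4^-1) 0 w * F (ray_point (tilt 4^-1) w.1))
  (fun w => M * (32 * cabs (kernel_cst t) *
    expR ((8 * norm2 x / t + 4 * B) ^+ 2 / (2 * (15 / 64 / t)))) * dominator (15 / 64 / t) w).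
- by move=> e _; exact: mK.
- exact: mK.
- by move=> w; case: (kernel_cvg b t x (tilt 4^-1) (F (ray_point (tilt 4^-1) w.1)) w).
- by move=> w; case: (kernel_cvg b t x (tilt 4^-1) (F (ray_point (tilt 4^-1) w.1)) w).
- rewrite /comp; under eq_fun do rewrite EFinM.
  by apply: integrableZl => //; exact: integrable_dominator.
- by move=> e w e0; apply: cabs_kernel_mul_le => //; exact: tilt_quarter_rate.
move=> c1 c2.
have near_eq : \forall e \near 0^'+, Psi_eps b F t x e =
    cint (@leb2 R \x leb)%E setT (fun w => kernel b t x (tilt 4^-1) e w *
                                           F (ray_point (tilt 4^-1) w.1)).
  by near=> e; apply: Pe; near: e; exact: nbhs_right_gt.
apply: complexRI.
  apply: cvg_lim => //; apply: cvg_trans c1; apply: near_eq_cvg.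
  by apply: filterS near_eq => e ->.
apply: cvg_lim => //; apply: cvg_trans c2; apply: near_eq_cvg.
by apply: filterS near_eq => e ->.
Unshelve. all: by end_near. Qed.

Lemma Psi_pwave b t x (k : R * R) : 0 < t ->
  Psi b (pwave k) t x =
  cint (@leb2 R \x leb)%E setT (fun w => kernel b t x (tilt 4^-1) 0 w *
                                         pwave k (ray_point (tilt 4^-1) w.1)).
Proof.
move=> t0; have k0 : 0 <= 2 * norm2 k by rewrite mulr_ge0// norm2_ge0.
apply: (@Psi_limit b (pwave k) t x 1 (2 * norm2 k) t0 ler01 k0
  (exp_growth_pwave k) (@cmeasurable2_pwave R k)) => eps e0.
rewrite kernel_rotation//.
exact: (Psi_eps_kernel b x t0 e0 ler01 k0 (exp_growth_pwave k) (@cmeasurable2_pwave R k)).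
Qed.

Section Superposition.
Variables (k0 : R) (mu : nat -> cmeasure R).
Hypothesis k00 : 0 <= k0.

Let swap b t x (tau eps delta : R) n : 0 < t -> 0 <= tau <= 4^-1 -> 0 < delta ->
  delta <= eps * complex.Re (tilt tau ^+ 4) + complex.Im (tilt tau ^+ 4) / (4 * t) ->
  cint (@leb2 R \x leb)%E setT (fun w => kernel b t x (tilt tau) eps w *
                                         Fmu k0 mu n (ray_point (tilt tau) w.1)) =
  cmint (mu n) (cball k0) (fun k => cint (@leb2 R \x leb)%E setT
    (fun w => kernel b t x (tilt tau) eps w * pwave k (ray_point (tilt tau) w.1))).
Proof.
move=> t0 tau01 d0 dle; have [m1 m2] := @cmeasurable_ray_point R (tilt tau).
have k20 : 0 <= 2 * k0 by rewrite mulr_ge0.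
apply: (@cint_mul_cmint_pwave R _ _ (@leb3 R) k0 (kernel b t x (tilt tau) eps)
  (fun w => ray_point (tilt tau) w.1)
  (fun w => 1 * (32 * cabs (kernel_cst t) *
    expR ((8 * norm2 x / t + 4 * (2 * k0)) ^+ 2 / (2 * delta))) * dominator delta w)).
- exact: cmeasurable_kernel.
- exact: (cmeasurable_comp measurable_fst m1).
- exact: (cmeasurable_comp measurable_fst m2).
- rewrite /comp; under eq_fun do rewrite EFinM.
  by apply: integrableZl => //; exact: integrable_dominator.
(* The general estimate is applied to the majorant of the plane waves itself, with [M = 1]; this
   gives the domination that Fubini asks for. *)
move=> w; pose F (z : R[i] * R[i]) : R[i] := (expR (2 * k0 * normC2 z))%:C.
have FE z : cabs (F z) = expR (2 * k0 * normC2 z).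
  by rewrite /F cabs_real ger0_norm ?expR_ge0.
rewrite -FE -cabsM; apply: cabs_kernel_mul_le => //.
by rewrite FE mul1r.
Qed.

Lemma cabs_kernel_cst t : 0 < t ->
  cabs (kernel_cst t) = (8 * pi * t)^-1 * cabs ((2 / Num.sqrt pi)%:C : R[i]).
Proof.
move=> t0; rewrite /kernel_cst cabsM cabsV; congr (_^-1 * _).
have -> : 8%:R * 'i * pi%:C * t%:C = 'i%C * (8 * pi * t)%:C :> R[i].
  by rewrite imagE !rmorphM rmorph_nat; ring.
by rewrite cabsM cabs_i mul1r cabs_real ger0_norm// !mulr_ge0 ?pi_ge0 ?(ltW t0).
Qed.

Lemma eq_cmint (m : cmeasure R) D (f g : R * R -> R[i]) : (forall k, D k -> f k = g k) ->
  cmint m D f = cmint m D g.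
Proof. by move=> fg; rewrite /cmint !(eq_cint _ fg). Qed.

Lemma Psi_Fmu b t x n : 0 < t ->
  Psi b (Fmu k0 mu n) t x =
  cint (@leb2 R \x leb)%E setT (fun w => kernel b t x (tilt 4^-1) 0 w *
                                         Fmu k0 mu n (ray_point (tilt 4^-1) w.1)).
Proof.
move=> t0; have [M M0 FMB] := exp_growth_Fmu k0 mu n.
have mF := @cmeasurable2_Fmu R k0 mu n.
have k20 : 0 <= 2 * k0 by rewrite mulr_ge0.
apply: (@Psi_limit b (Fmu k0 mu n) t x M (2 * k0) t0 M0 k20 FMB mF) => eps e0.
have e20 : 0 < eps / 2 by rewrite divr_gt0.
rewrite (Psi_eps_kernel b x t0 e0 M0 k20 FMB mF).
(* Exchanging with [mu n] at both tilts leaves the rotation to be done for one plane wave at a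
   time. *)
rewrite (swap _ _ _ t0 quarter e20 (tilt_rate t0 e0 quarter)).
rewrite (swap _ _ _ t0 zero_quarter e20 (tilt_rate t0 e0 zero_quarter)).
by apply: eq_cmint => k _; rewrite kernel_rotation.
Qed.

Lemma Psi_superposition b t x n : 0 < t ->
  Psi b (Fmu k0 mu n) t x = cmint (mu n) (cball k0) (fun k => Psi b (pwave k) t x).
Proof.
move=> t0; have d0 : 0 < 15 / 64 / t by rewrite !divr_gt0.
rewrite Psi_Fmu// (swap _ _ _ t0 quarter d0 (tilt_quarter_rate t0 (lexx 0))).
by apply: eq_cmint => k _; rewrite Psi_pwave.
Qed.

(** Each factor is taken at its worst over [[t1, t2]] and [|x| <= r]: the prefactor and the linear
    exponent at the earliest time, the Gaussian rate at the latest. The bound thus no longer depends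
    on the point, and it is linear in [e]. *)
Lemma cabs_Psi_sub_le b t x n (a : R * R) (t1 t2 r B e : R) :
  0 < t1 -> t1 <= t <= t2 -> norm2 x <= r -> 0 <= B -> 0 <= e ->
  (forall z, cabs (Fmu k0 mu n z - pwave a z) <= e * expR (B * normC2 z)) ->
  cabs (Psi b (Fmu k0 mu n) t x - Psi b (pwave a) t x) <=
  2 * (e * (32 * cabs (kernel_cst t1) *
    expR ((8 * r / t1 + 4 * B) ^+ 2 / (2 * (15 / 64 / t2))))) *
    Rintegral (@leb2 R \x leb)%E setT (dominator (15 / 64 / t2)).
Proof.
move=> t10 /andP[t1t tt2] xr B0 e0 FB.
have t0 : 0 < t by exact: lt_le_trans t1t.
have t20 : 0 < t2 by exact: lt_le_trans tt2.
have d0 : 0 < 15 / 64 / t2 by rewrite !divr_gt0.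
have dt : 15 / 64 / t2 <= 15 / 64 / t by rewrite ler_wpM2l ?divr_ge0// lef_pV2.
have rate := le_trans dt (tilt_quarter_rate t0 (lexx 0)).
have [M M0 FMB] := exp_growth_Fmu k0 mu n.
have k20 : 0 <= 2 * k0 by rewrite mulr_ge0.
have a0 : 0 <= 2 * norm2 a by rewrite mulr_ge0// norm2_ge0.
have i1 := cintegrable_kernel_mul b x t0 quarter d0 rate M0 k20 FMB (@cmeasurable2_Fmu R k0 mu n).
have i2 := cintegrable_kernel_mul b x t0 quarter d0 rate ler01 a0 (exp_growth_pwave a)
  (@cmeasurable2_pwave R a).
rewrite Psi_Fmu// Psi_pwave// -(cintB i1 i2).
have r0 : 0 <= r by apply: le_trans xr; exact: norm2_ge0.
set C := e * _.
have idom := integrable_dominator d0.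
rewrite -mulrA -RintegralZl//; apply: cabs_cint_le.
- have [m1 m2] := @cmeasurable_ray_point R (tilt 4^-1).
  have mF (F : R[i] * R[i] -> R[i]) : cmeasurable2 F ->
      cmeasurable (fun w : (R * R) * R =>
        kernel b t x (tilt 4^-1) 0 w * F (ray_point (tilt 4^-1) w.1)).
    move=> mF; apply: cmeasurableM; first exact: cmeasurable_kernel.
    apply: (mF _ ((R * R) * R)%type (fun w => (ray_point (tilt 4^-1) w.1).1)
      (fun w => (ray_point (tilt 4^-1) w.1).2)).
      exact: (cmeasurable_comp measurable_fst m1).
    exact: (cmeasurable_comp measurable_fst m2).
  apply: cmeasurableD; first exact: mF (@cmeasurable2_Fmu R k0 mu n).
  by apply: cmeasurableN; exact: mF (@cmeasurable2_pwave R a).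
- rewrite /comp; under eq_fun do rewrite EFinM.
  exact: integrableZl.
move=> w; rewrite -mulrBr.
have := @cabs_kernel_mul_le R b t x 4^-1 0 (15 / 64 / t2) e B
  (fun z => Fmu k0 mu n z - pwave a z) w t0 quarter d0 rate e0 B0 (FB _).
move=> /le_trans; apply; rewrite ler_wpM2r//.
  by rewrite /dominator !mulr_ge0 ?expR_ge0.
rewrite /C ler_wpM2l// ler_pM ?mulr_ge0 ?cabs_ge0 ?expR_ge0//.
  rewrite ler_wpM2l// !cabs_kernel_cst// ler_wpM2r ?cabs_ge0//.
  by rewrite lef_pV2 ?posrE ?mulr_gt0 ?pi_gt0// ler_wpM2l ?mulr_ge0 ?pi_ge0.
rewrite ler_expR; apply: ler_wpM2r; first by rewrite invr_ge0 mulr_ge0 ?(ltW d0).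
have h : 8 * norm2 x / t <= 8 * r / t1.
  rewrite ler_pM ?mulr_ge0 ?norm2_ge0 ?invr_ge0 ?(ltW t0)//.
    by rewrite ler_wpM2l.
  by rewrite lef_pV2.
have h0 : 0 <= 8 * norm2 x / t by rewrite divr_ge0 ?mulr_ge0 ?norm2_ge0 ?(ltW t0).
have B4 : 0 <= 4 * B by rewrite mulr_ge0.
by apply: lerXn2r; rewrite ?nnegrE ?addr_ge0 ?lerD2r// (le_trans h0).
Qed.

End Superposition.

End RotatedRepresentation.

(** The projection of [K] to the time axis is compact, hence closed, and misses 0; a whole ball
    around 0 then avoids it, and its radius is [t1]. *)
Lemma compact_time_space_bounds {R : realType} (K : set (R * (R * R))) : compact K ->
  K `<=` [set p | 0 < p.1 /\ Omega p.2] ->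
  exists t1 t2 r : R, 0 < t1 /\ forall p, K p -> t1 <= p.1 <= t2 /\ norm2 p.2 <= r.
Proof.
move=> cK KO.
have cf : compact [set p.1 | p in K].
  by apply: continuous_compact => //; apply: continuous_subspaceT => p; exact: cvg_fst.
have [t1 /= t10 ht1] : exists2 e : R, 0 < e & ball 0 e `<=` ~` [set p.1 | p in K].
  have : nbhs (0 : R) (~` [set p.1 | p in K]).
    apply: open_nbhs_nbhs; split.
      by apply: closed_openC; apply: compact_closed => //; exact: Rhausdorff.
    by move=> [p /KO [+ _] p0]; rewrite p0 ltxx.
  by move=> /nbhs_ballP.
have [M [_ hM]] := compact_bounded cK.
(* Boundedness is available for numbers strictly above [M], hence [M + 1]. The factor 2 passes from
   the maximum norm of the product to [norm2]. *)
exists t1, (M + 1), (2 * (M + 1)); split => // p Kp.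
have : `|p| <= M + 1 by apply: hM => //; rewrite ltrDl.
rewrite prod_normE ge_max prod_normE ge_max => /and3P[p1 x1 x2].
have [p10 _] := KO _ Kp.
split; last first.
  apply: le_trans (cabs_le_ReIm (p.2.1 +i* p.2.2)) _.
  by rewrite mulr_natl mulr2n lerD.
apply/andP; split; last by rewrite (le_trans (ler_norm _)).
rewrite leNgt; apply/negP => pt1; apply: (ht1 p.1); last by exists p.
by rewrite /ball/= sub0r normrN gtr0_norm.
Qed.

Theorem theorem4p3 (R : realType) (k0 : R) (mu : nat -> cmeasure R) (a : R * R) :
  0 < k0 -> k0 < norm2 a ->
  cvgA1 (Fmu k0 mu) (pwave a) ->
  forall b : bc,
    (forall (t : R) (x : R * R) (n : nat), 0 < t -> Omega x ->
       Psi b (Fmu k0 mu n) t x = cmint (mu n) (cball k0) (fun k => Psi b (pwave k) t x))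
    /\
    (forall K : set (R * (R * R)), compact K ->
       K `<=` [set p | 0 < p.1 /\ Omega p.2] ->
       forall e : R, 0 < e -> exists N : nat, forall n, (N <= n)%N ->
         forall p, K p ->
           cabs (Psi b (Fmu k0 mu n) p.1 p.2 - Psi b (pwave a) p.1 p.2) <= e).
Proof.
move=> k00 _ [B [B0 cvgF]] b; split=> [t x n t0 _|K cK KO e e0].
  exact: (Psi_superposition mu (ltW k00)).
have [t1 [t2 [r [t10 hK]]]] := compact_time_space_bounds cK KO.
(* This is the bound of [cabs_Psi_sub_le] at accuracy 1. The convergence in [A_1] is used at
   accuracy [e / (c + 1)], where the added 1 keeps the denominator positive. *)
pose c := 2 * (32 * cabs (kernel_cst t1) *
  expR ((8 * r / t1 + 4 * B) ^+ 2 / (2 * (15 / 64 / t2)))) *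
  Rintegral (@leb2 R \x @lebesgue_measure R)%E setT (dominator (15 / 64 / t2)).
have c0 : 0 <= c.
  rewrite !mulr_ge0 ?cabs_ge0 ?expR_ge0//; apply: Rintegral_ge0 => w _.
  by rewrite /dominator !mulr_ge0 ?expR_ge0.
have c1 : 0 < c + 1 by rewrite ltr_pwDr.
have ec : 0 < e / (c + 1) by rewrite divr_gt0.
have [N hN] := cvgF _ ec; exists N => n Nn p Kp.
have [t12 xr] := hK p Kp.
have FB z : cabs (Fmu k0 mu n z - pwave a z) <= e / (c + 1) * expR (B * normC2 z).
  by have := hN n Nn z; rewrite [- B * _]mulNr expRN ler_pdivrMr ?expR_gt0.
apply: le_trans (cabs_Psi_sub_le (ltW k00) b t10 t12 xr B0 (ltW ec) FB) _.
rewrite [leLHS](_ : _ = e * (c / (c + 1))); last by rewrite /c; ring.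
by rewrite ler_piMr ?(ltW e0)// ler_pdivrMr// mul1r lerDl.
Qed.
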